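(* Fix $\boldsymbol x_0\in(0,\infty)^d$ and let $f\in\mathcal F_{SMU}(d)$ be continuously differentiable at $\boldsymbol x_0$ with $f(\boldsymbol x_0)>0$. Suppose there is an open ball $A(\boldsymbol x_0)\subseteq(0,\infty)^d$ around $\boldsymbol x_0$ on which $f$ is everywhere strictly positive, on which the partial derivatives $\partial f/\partial x_j$, $j=1,\dots,d$, exist and are continuous, with $\frac{\partial f}{\partial x_j}(\boldsymbol x_0)<0$ for all $j$, and on which the full mixed derivative $\partial^df/(\partial x_1\cdots\partial x_d)$ exists, is continuous and satisfies $$(-1)^d\frac{\partial^df}{\partial x_1\cdots\partial x_d}(\boldsymbol y)>0\quad\text{for all }\boldsymbol y\in A(\boldsymbol x_0).$$ Then there is a sequence $\{f_n\}\subset\mathcal F_{SMU}(d)$ such that any sequence of estimators $\{T_n\}$ of $f(\boldsymbol x_0)$ (with $T_n$ based on $n$ i.i.d. observations) satisfies $$\liminf_{n\to\infty}\max\Big\{E_{f_n}\big\{n^{1/3}|T_n-f_n(\boldsymbol x_0)|\big\},\,E_f\big\{n^{1/3}|T_n-f(\boldsymbol x_0)|\big\}\Big\}\ \ge\ \frac{e^{-1/3}}{2^d}\,\{3^{d-1}\}^{1/3}\left\{(-1)^d\frac{\partial^df}{\partial x_1\cdots\partial x_d}(\boldsymbol x_0)\cdot f(\boldsymbol x_0)\right\}^{1/3}.$$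
   Context: For $\boldsymbol v\in(0,\infty)^d$ write $|\boldsymbol v|=\prod_{i=1}^d v_i$ and $(\boldsymbol 0,\boldsymbol v]=\prod_i(0,v_i]$. $\mathcal F_{SMU}(d)$ is the class of densities on $(0,\infty)^d$ of the form $f_G(\boldsymbol x)=\int_{(0,\infty)^d}\frac1{|\boldsymbol v|}\mathbf 1_{(\boldsymbol 0,\boldsymbol v]}(\boldsymbol x)\,dG(\boldsymbol v)$ with $G$ (the distribution function of) a probability measure on $(0,\infty)^d$. An estimator $T_n$ is a measurable real-valued function of $\boldsymbol X_1,\dots,\boldsymbol X_n$; $E_g$ denotes expectation when $\boldsymbol X_1,\dots,\boldsymbol X_n$ are i.i.d. with density $g$. *)

(* Defs.v *)
From HB Require Import structures.
From mathcomp Require Import all_boot all_order all_algebra.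
From mathcomp Require Import all_classical all_reals all_analysis.
From mathcomp Require Import measurable_realfun.

Set Implicit Arguments.
Unset Strict Implicit.
Unset Printing Implicit Defensive.

Import Order.TTheory GRing.Theory Num.Theory.
Import numFieldNormedType.Exports.

Local Open Scope classical_set_scope.
Local Open Scope ring_scope.

(* The Borel sigma-algebra of R^d is generated by the coordinate maps. *)
Section measurable_rV.
Context (R : realType) (d : nat).

Let coord (i : 'I_d) (x : 'rV[R]_d) : measurableTypeR R := x ord0 i.

Let rV_set0 : g_sigma_preimage coord set0.
Proof. exact: sigma_algebra0. Qed.

Let rV_setC A : g_sigma_preimage coord A -> g_sigma_preimage coord (~` A).
Proof. exact: sigma_algebraC. Qed.

Let rV_bigcup (F : (set 'rV[R]_d)^nat) :
  (forall i, g_sigma_preimage coord (F i)) ->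
  g_sigma_preimage coord (\bigcup_i (F i)).
Proof. exact: sigma_algebra_bigcup. Qed.

HB.instance Definition _ := @isMeasurable.Build default_measure_display
  'rV[R]_d (g_sigma_preimage coord) rV_set0 rV_setC rV_bigcup.

End measurable_rV.

(* The n-fold power of a measure, on n-tuples: the point mass when n = 0, and
   for n.+1 the image of mu \x mu^n under (x, t) |-> x :: t. *)
Section cons_measure.
Context d (T : measurableType d) (R : realType) (n : nat).
Variables (mu : {sigma_finite_measure set T -> \bar R})
          (nu : {sigma_finite_measure set (n.-tuple T) -> \bar R}).

Definition tuple_cons (p : T * n.-tuple T) : n.+1.-tuple T :=
  [tuple of p.1 :: p.2].

Lemma measurable_tuple_cons : measurable_fun [set: T * n.-tuple T] tuple_cons.
Proof. exact: measurable_cons. Qed.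

HB.instance Definition _ := @isMeasurableFun.Build _ _ _ _ tuple_cons
  measurable_tuple_cons.

Definition cons_measure : set (n.+1.-tuple T) -> \bar R :=
  pushforward (mu \x nu)%E tuple_cons.

Let cons_measure0 : cons_measure set0 = 0%E.
Proof. exact: measure0. Qed.

Let cons_measure_ge0 A : (0 <= cons_measure A)%E.
Proof. exact: measure_ge0. Qed.

Let cons_measure_sigma_additive : semi_sigma_additive cons_measure.
Proof. exact: measure_semi_sigma_additive. Qed.

HB.instance Definition _ := isMeasure.Build _ _ _ cons_measure
  cons_measure0 cons_measure_ge0 cons_measure_sigma_additive.

Let cons_measure_sigma_finite : sigma_finite [set: n.+1.-tuple T] cons_measure.
Proof.
have /sigma_finiteP[F [FT ndF Foo]] := sigma_finiteT mu.
have /sigma_finiteP[H [HT ndH Hoo]] := sigma_finiteT nu.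
have FHT : \bigcup_k (F k `*` H k) = [set: T * n.-tuple T].
  apply/seteqP; split=> // -[x t] _.
  have [i _ Fx] : (\bigcup_k F k) x by rewrite -FT.
  have [j _ Ht] : (\bigcup_k H k) t by rewrite -HT.
  exists (maxn i j) => //; split => /=.
    by move: x Fx; exact/subsetPset/ndF/leq_maxl.
  by move: t Ht; exact/subsetPset/ndH/leq_maxr.
pose uncons (t : n.+1.-tuple T) := (thead t, [tuple of behead t]).
have consK p : uncons (tuple_cons p) = p.
  by case: p => x t; congr pair; exact/val_inj.
have muncons : measurable_fun [set: n.+1.-tuple T] uncons.
  apply/measurable_fun_pair; last exact: measurable_behead.
  exact: measurable_tnth.
exists (fun k => uncons @^-1` (F k `*` H k)).
  by rewrite -preimage_bigcup FHT preimage_setT.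
move=> k; have [mF Fk] := Foo k; have [mH Hk] := Hoo k; split.
  by rewrite -[X in measurable X]setTI; apply: muncons => //; exact: measurableX.
rewrite /cons_measure /pushforward -comp_preimage.
rewrite (_ : uncons \o tuple_cons = id); last exact/funext.
by rewrite preimage_id product_measure1E// lte_mul_pinfty// ge0_fin_numE.
Qed.

HB.instance Definition _ := Measure_isSigmaFinite.Build _ _ _ cons_measure
  cons_measure_sigma_finite.

End cons_measure.

Fixpoint power_measure d (T : measurableType d) (R : realType)
    (mu : {sigma_finite_measure set T -> \bar R}) (n : nat) :
    {sigma_finite_measure set (n.-tuple T) -> \bar R} :=
  if n is m.+1 then cons_measure mu (power_measure mu m)
  else \d_ [tuple of [::]].

(* Joint law of n independent observations with common law P. *)
Section iid_law.
Context d (T : measurableType d) (R : realType) (P : probability T R) (n : nat).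

Definition iid_law : set (n.-tuple T) -> \bar R := power_measure P n.

HB.instance Definition _ := Measure.on iid_law.

Let iid_law_setT : iid_law [set: n.-tuple T] = 1%E.
Proof.
rewrite /iid_law; elim: n => [|m IH] /=; first by rewrite diracT.
rewrite /cons_measure /pushforward preimage_setT -setXTT product_measure1E//.
by rewrite IH mule1; exact: probability_setT.
Qed.

HB.instance Definition _ := Measure_isProbability.Build _ _ _ iid_law
  iid_law_setT.

End iid_law.
Arguments iid_law {d T R} P n.

Section lebesgue_rV.
Context (R : realType) (d : nat).

Definition row_of_tuple (t : d.-tuple (measurableTypeR R)) : 'rV[R]_d :=
  \row_i tnth t i.

Lemma measurable_row_of_tuple :
  measurable_fun [set: d.-tuple (measurableTypeR R)] row_of_tuple.
Proof.
pose coord (i : 'I_d) (x : 'rV[R]_d) : measurableTypeR R := x ord0 i.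
move=> _ A mA.
have -> : measurable = g_sigma_preimage (fun i => coord i \o row_of_tuple).
  congr g_sigma_preimage; apply/funext => i; apply/funext => t /=.
  by rewrite /coord /row_of_tuple mxE.
by rewrite g_sigma_preimage_comp; exists A.
Qed.

HB.instance Definition _ := @isMeasurableFun.Build _ _ _ _ row_of_tuple
  measurable_row_of_tuple.

Definition lebesgue_rV : set 'rV[R]_d -> \bar R :=
  pushforward (power_measure lebesgue_measure d) row_of_tuple.

Let lebesgue_rV0 : lebesgue_rV set0 = 0%E.
Proof. exact: measure0. Qed.

Let lebesgue_rV_ge0 A : (0 <= lebesgue_rV A)%E.
Proof. exact: measure_ge0. Qed.

Let lebesgue_rV_sigma_additive : semi_sigma_additive lebesgue_rV.
Proof. exact: measure_semi_sigma_additive. Qed.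

HB.instance Definition _ := isMeasure.Build _ _ _ lebesgue_rV
  lebesgue_rV0 lebesgue_rV_ge0 lebesgue_rV_sigma_additive.

End lebesgue_rV.
Arguments lebesgue_rV {R d}.

Record density (R : realType) (d : nat) := Density {
  pdf :> 'rV[R]_d -> R;
  measurable_pdf : measurable_fun [set: 'rV[R]_d] pdf;
  pdf_ge0 : forall x, 0 <= pdf x;
  integral_pdf : (\int[lebesgue_rV]_x (pdf x)%:E = 1)%E }.

Section density_law.
Context (R : realType) (d : nat) (f : density R d).
Local Open Scope ereal_scope.

Definition density_law (A : set 'rV[R]_d) : \bar R :=
  \int[lebesgue_rV]_(x in A) (f x)%:E.

Let density_law0 : density_law set0 = 0.
Proof. by rewrite /density_law integral_set0. Qed.

Let density_law_ge0 A : 0 <= density_law A.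
Proof. by apply: integral_ge0 => x _; rewrite lee_fin pdf_ge0. Qed.

Let density_law_sigma_additive : semi_sigma_additive density_law.
Proof.
move=> F mF tF mUF; rewrite /density_law ge0_integral_bigcup//.
- by apply: is_cvg_ereal_nneg_natsum => k _; apply: integral_ge0 => x _;
    rewrite lee_fin pdf_ge0.
- apply/measurable_EFinP; apply: measurable_funS (measurable_pdf f) => //.
- by move=> x _; rewrite lee_fin pdf_ge0.
Qed.

HB.instance Definition _ := isMeasure.Build _ _ _ density_law
  density_law0 density_law_ge0 density_law_sigma_additive.

Let density_law_setT : density_law setT = 1.
Proof. exact: integral_pdf. Qed.

HB.instance Definition _ := Measure_isProbability.Build _ _ _ density_law
  density_law_setT.

End density_law.

Section smu.
Context (R : realType) (d : nat).

Definition orthant : set 'rV[R]_d := [set v | forall i, 0 < v ord0 i].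

(* The box (0, v]. *)
Definition lower_box (v : 'rV[R]_d) : set 'rV[R]_d :=
  [set x | forall i, 0 < x ord0 i <= v ord0 i].

Definition smu_mixture (G : probability 'rV[R]_d R) (x : 'rV[R]_d) : R :=
  \int[G]_(v in orthant) ((\prod_(i < d) v ord0 i)^-1 * \1_(lower_box v) x).

(* Densities on the orthant are identified with their extension by 0 to R^d. *)
Definition F_SMU (f : density R d) : Prop :=
  exists G : probability 'rV[R]_d R,
    G orthant = 1%E /\ forall x, f x = smu_mixture G x.

End smu.
Arguments orthant {R d}.

Section derivatives.
Context (R : realType) (d : nat).
Implicit Types (f : 'rV[R]_d -> R) (A : set 'rV[R]_d) (s : seq 'I_d).

Definition partial (i : 'I_d) f (x : 'rV[R]_d) : R := 'D_(delta_mx ord0 i) f x.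

(* iter_partial [:: i1; ..; ik] f is d/dx_i1 (... (d/dx_ik f)). *)
Definition iter_partial s f : 'rV[R]_d -> R := foldr partial f s.

Fixpoint iter_partial_exists A s f : Prop :=
  if s is i :: s' then
    iter_partial_exists A s' f /\
    forall x, A x -> derivable (iter_partial s' f) x (delta_mx ord0 i)
  else True.

Definition mixed_partial f : 'rV[R]_d -> R := iter_partial (enum 'I_d) f.

Definition mixed_partial_exists A f : Prop :=
  iter_partial_exists A (enum 'I_d) f.

Definition continuously_differentiable_at f (x : 'rV[R]_d) : Prop :=
  (\forall y \near x, differentiable f y) /\
  forall i, {for x, continuous (partial i f)}.

(* The library's ball on 'rV[R]_d is the one of the sup norm. *)
Definition euclidean_ball (x : 'rV[R]_d) (r : R) : set 'rV[R]_d :=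
  [set y | \sum_(i < d) (y ord0 i - x ord0 i) ^+ 2 < r ^+ 2].

End derivatives.

(* Main.v *)
Require Import Defs.
From HB Require Import structures.
From mathcomp Require Import all_boot all_order all_algebra.
From mathcomp Require Import all_classical all_reals all_analysis.
From mathcomp Require Import measurable_realfun ring lra.

(** The bound comes from Le Cam's two-point method: no estimator can be close
to both [f x0] and [g x0] when the n-fold products of [f] and [g] overlap, so it
suffices to find [g] in the class with [g x0 - f x0] of order [n^(-1/3)] whose
Hellinger distance to [f] is of order [n^(-1/2)].

Write the mixture as [f x = mu {v | x <= v}] with [mu (dv) = dG(v) / |v|].  Near
[x0] the measure [mu] has density [(-1)^d] times the mixed partial derivative of
[f], so on a small box one may add to [mu] any signed density bounded below by
[- kappa], where [kappa] is slightly smaller than that quantity at [x0].  The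
choice is a product [kappa * 7^-(d-1) * prod_i s_i(v_i)], where [s_i] is [-1] on
the interval of length [h] before [x0_i] and [7] on the interval of length [h/7]
after it.  Every [s_i] has integral zero, so the change of [f] is a product of
tents: it vanishes outside a box of side [2h] and its height at [x0] is
[kappa * 7^-(d-1) * h^d].  Its mass [m] is of smaller order, and dividing by
[1 + m] gives back a density of the class ([perturbed_density_SMU]).

That [mu] dominates [kappa] times Lebesgue measure on the box is the delicate
point.  On a grid cell the [mu]-mass is an alternating sum of the values of [f]
at the corners ([scaled_mixing_slab]), which an iterated mean value theorem turns
into the volume of the cell times the signed mixed derivative at a point of the box
([iter_nabla_mean_value]).  An inequality between measures does not pass from
cells to Borel sets by a Dynkin class argument, but it does by approximating a
Borel set by finite unions of cells ([le_measure_from_algebra]).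

For the statistical part, [sqrt (1 + t) >= 1 + t/2 - t^2/8] bounds the affinity
of [f] and the perturbation below by [1 - (int phi^2)/(8 fmin)], with [phi] the
product of tents and [fmin] a lower bound of [f] on the box ([affinity_ge]).
Taking [h] such that this equals [1 - 1/(10 n)], the affinity of the n-fold
products is at least [9/10], and then the maximal risk is at least [11/39] of
[g x0 - f x0] ([two_point_risk]).

The slope [7] is chosen to make the constants match in every dimension.  With it,
[n * (phi x0)^3 = 28/5 * (3/8)^d * kappa * fmin], while the cube of the announced
constant is [exp (-1) * 8^-d * 3^(d-1)] times the limit of [kappa * fmin]; the
powers of [3/8] cancel and what is left is the numerical inequality
[(11/39)^3 * (84/5) > exp (-1)].  It holds with some room, which pays for
replacing the limits by [1 - 1/1000] of their values ([constant_le]). *)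

Set Implicit Arguments.
Unset Strict Implicit.
Unset Printing Implicit Defensive.

Import Order.TTheory GRing.Theory Num.Theory.
Import numFieldNormedType.Exports.

Local Open Scope classical_set_scope.
Local Open Scope ring_scope.

(** * Weighted measures, differences of measures, comparison of measures *)

Section change_of_measure.
Context d (T : measurableType d) (R : realType).
Variables (mu nu : {measure set T -> \bar R}) (k : T -> R).
Hypothesis mk : measurable_fun setT k.
Hypothesis k0 : forall x, 0 <= k x.
Hypothesis nuE : forall A, measurable A -> nu A = (\int[mu]_(x in A) (k x)%:E)%E.

Import HBNNSimple.

Let change_nnsfun (f : {nnsfun T >-> R}) :
  (\int[nu]_x (f x)%:E = \int[mu]_x ((f x)%:E * (k x)%:E))%E.
Proof.
rewrite integralT_nnsfun sintegralE.
under [RHS]eq_integral => x _.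
  rewrite fimfunE -fsumEFin// ge0_mule_fsuml; last first.
    by move=> r /=; rewrite EFinM nnfun_muleindic_ge0.
  over.
rewrite ge0_integral_fsum//; last 2 first.
  - move=> r; apply: emeasurable_funM; last exact/measurable_EFinP.
    by apply/measurable_EFinP; exact: measurable_funM.
  - move=> r t _; apply: mule_ge0; last by rewrite lee_fin.
    by rewrite EFinM nnfun_muleindic_ge0.
apply: eq_fsbigr => r /[!inE] rf; rewrite nuE//.
rewrite integral_mkcond -ge0_integralZl//=; last 3 first.
  - have mD : measurable (f @^-1` [set r]) by [].
    apply/(measurable_restrictT (fun x => (k x)%:E) mD).
    by apply: measurable_funTS; apply/measurable_EFinP.
  - by move=> x _; rewrite /patch; case: ifPn => // _; rewrite lee_fin k0.
  - by case: rf => y _ <-; rewrite lee_fin.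
apply: eq_integral => x _; rewrite /patch indicE.
by case: (x \in _) => /=; rewrite ?mulr1 ?mulr0 ?mul0e ?mule0.
Qed.

Lemma ge0_integral_density (h : T -> \bar R) :
  measurable_fun setT h -> (forall x, 0 <= h x)%E ->
  (\int[nu]_x h x = \int[mu]_x (h x * (k x)%:E))%E.
Proof.
move=> mh h0; pose h_ := nnsfun_approx measurableT mh.
have cvh x : (fun n => (h_ n x)%:E) @ \oo --> h x.
  exact: (cvg_nnsfun_approx measurableT mh (fun x _ => h0 x) Logic.I).
have ndh x : {homo (fun n => (h_ n x)%:E) : a b / (a <= b)%N >-> (a <= b)%E}.
  by move=> a b ab; rewrite lee_fin; exact/lefP/nd_nnsfun_approx.
transitivity (limn (fun n => \int[nu]_x (h_ n x)%:E)%E).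
  rewrite -monotone_convergence//.
  - by apply: eq_integral => x _; apply/esym/cvg_lim.
  - by move=> n; exact/measurable_EFinP.
  - by move=> n x _; rewrite lee_fin.
under eq_fun do rewrite change_nnsfun.
rewrite -monotone_convergence//.
- apply: eq_integral => x _; apply/cvg_lim => //.
  by apply: cvgeZr => //; exact: cvh.
- move=> n; apply: emeasurable_funM; exact/measurable_EFinP.
- by move=> n x _; rewrite mule_ge0// lee_fin.
- by move=> x _ a b ab; rewrite lee_wpmul2r// ?lee_fin//; exact/lefP/nd_nnsfun_approx.
Qed.

End change_of_measure.

Section measure_difference.
Context d (T : measurableType d) (R : realType).
Variables (mu nu : {measure set T -> \bar R}).
Hypothesis fmu : fin_num_fun mu.
Hypothesis fnu : fin_num_fun nu.
Hypothesis nu_le_mu : forall A, measurable A -> (nu A <= mu A)%E.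

(** The truncation at 0 only matters on non-measurable sets: it makes the
difference nonnegative there, as the structure of measure asks. *)
Definition mdiff (_ : fin_num_fun mu) (_ : fin_num_fun nu)
    (_ : forall A, measurable A -> (nu A <= mu A)%E) (A : set T) :=
  maxe 0%E (mu A - nu A)%E.

Local Notation diff := (mdiff fmu fnu nu_le_mu).

Lemma mdiffE A : measurable A -> (mu A = diff A + nu A)%E.
Proof.
move=> mA; rewrite /mdiff max_r; last first.
  by rewrite sube_ge0 ?nu_le_mu// ?fmu ?fnu.
by rewrite subeK// fnu.
Qed.

Let mdiff0 : diff set0 = 0%E.
Proof. by rewrite /mdiff !measure0 sube0 maxxx. Qed.

Let mdiff_ge0 A : (0 <= diff A)%E.
Proof. by rewrite le_max lexx. Qed.

Let mdiff_sigma_additive : semi_sigma_additive diff.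
Proof.
move=> F mF tF mUF.
have E A : measurable A -> diff A = (mu A - nu A)%E.
  by move=> mA; rewrite (mdiffE mA) addeK// fnu.
have -> : (fun n => \sum_(0 <= i < n) diff (F i))%E =
    ((fun n => \sum_(0 <= i < n) mu (F i)) \-
     (fun n => \sum_(0 <= i < n) nu (F i)))%E.
  apply/funext => n; rewrite /= -fin_num_sumeN//; last by move=> *; rewrite fnu.
  by rewrite -big_split/=; apply: eq_bigr => i _; rewrite E.
rewrite E//.
apply: cvgeB.
- by apply: fin_num_adde_defl; rewrite fin_numN fnu.
- exact: measure_semi_sigma_additive.
- exact: measure_semi_sigma_additive.
Qed.

HB.instance Definition _ := isMeasure.Build _ _ _ diff
  mdiff0 mdiff_ge0 mdiff_sigma_additive.

End measure_difference.

(** Stated as a sum because extended real subtraction would need finiteness of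
the integrals. *)
Lemma ge0_integral_mdiff d (T : measurableType d) (R : realType)
    (mu nu : {measure set T -> \bar R}) (fmu : fin_num_fun mu)
    (fnu : fin_num_fun nu)
    (le : forall A, measurable A -> (nu A <= mu A)%E) (h : T -> \bar R) :
  measurable_fun setT h -> (forall x, 0 <= h x)%E ->
  (\int[mu]_x h x = \int[mdiff fmu fnu le]_x h x + \int[nu]_x h x)%E.
Proof.
move=> mh h0; rewrite -ge0_integral_measure_add//.
apply: eq_measure_integral => A mA _.
by rewrite [LHS](mdiffE fmu fnu le mA); apply/esym; exact: measure_addE.
Qed.

Lemma ge0_le_integral_measure d (T : measurableType d) (R : realType)
    (mu nu : {measure set T -> \bar R}) (h : T -> \bar R) :
  fin_num_fun mu -> fin_num_fun nu ->
  (forall A, measurable A -> (nu A <= mu A)%E) ->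
  measurable_fun setT h -> (forall x, 0 <= h x)%E ->
  (\int[nu]_x h x <= \int[mu]_x h x)%E.
Proof.
move=> fmu fnu le mh h0; rewrite (ge0_integral_mdiff fmu fnu le mh h0).
by rewrite leeDr// integral_ge0.
Qed.

Section weighted_measure.
Context d (T : measurableType d) (R : realType).
Variables (mu : {measure set T -> \bar R}) (k : T -> R).
Hypothesis mk : measurable_fun setT k.
Hypothesis k0 : forall x, 0 <= k x.

Definition wmeasure (_ : measurable_fun setT k) (_ : forall x, 0 <= k x)
  (A : set T) : \bar R := (\int[mu]_(x in A) (k x)%:E)%E.

Local Notation wmu := (wmeasure mk k0).

Let wmu0 : wmu set0 = 0%E.
Proof. by rewrite /wmeasure integral_set0. Qed.

Let wmu_ge0 A : (0 <= wmu A)%E.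
Proof. by apply: integral_ge0 => x _; rewrite lee_fin. Qed.

Let wmu_sigma_additive : semi_sigma_additive wmu.
Proof.
move=> F mF tF mUF; rewrite /wmeasure ge0_integral_bigcup//.
- by apply: is_cvg_ereal_nneg_natsum => n _; exact: wmu_ge0.
- by apply/measurable_EFinP; exact: measurable_funS mk.
- by move=> x _; rewrite lee_fin.
Qed.

HB.instance Definition _ := isMeasure.Build _ _ _ wmu
  wmu0 wmu_ge0 wmu_sigma_additive.

Lemma ge0_integral_wmeasure (h : T -> \bar R) :
  measurable_fun setT h -> (forall x, 0 <= h x)%E ->
  (\int[wmu]_x h x = \int[mu]_x (h x * (k x)%:E))%E.
Proof. by move=> mh hpos; exact: ge0_integral_density. Qed.

Lemma wmeasure_fin_num_fun : (\int[mu]_x (k x)%:E < +oo)%E -> fin_num_fun wmu.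
Proof.
move=> fk A mA; rewrite ge0_fin_numE//; apply: le_lt_trans fk.
by apply: ge0_subset_integral => //;
  [exact/measurable_EFinP|move=> x _; rewrite lee_fin].
Qed.

End weighted_measure.

Section approximation_by_algebra.
Context d (T : measurableType d) (R : realType).
Variables (mu : {measure set T -> \bar R}) (G : set (set T)).
Hypothesis finm : fin_num_fun mu.
Hypothesis mG : G `<=` measurable.
Hypothesis G0 : G set0.
Hypothesis GC : forall A, G A -> G (~` A).
Hypothesis GU : forall A B, G A -> G B -> G (A `|` B).

Definition symdiff (A B : set T) := (A `\` B) `|` (B `\` A).

Definition approximable (A : set T) := measurable A /\
  forall e : R, 0 < e -> exists2 U, G U & (mu (symdiff A U) < e%:E)%E.

Let msymdiff A B : measurable A -> measurable B -> measurable (symdiff A B).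
Proof. by move=> mA mB; apply: measurableU; exact: measurableD. Qed.

Let approximableC A : approximable A -> approximable (~` A).
Proof.
move=> [mA aA]; split; first exact: measurableC.
move=> e /aA[U GU' AU]; exists (~` U); first exact: GC.
rewrite (_ : symdiff _ _ = symdiff A U)// /symdiff !setDE !setCK.
by rewrite setUC setIC (setIC U).
Qed.

Let lt_symdiff A B C D e1 e2 : measurable A -> measurable B -> measurable C ->
  measurable D -> measurable C -> symdiff A B `<=` C `|` D ->
  (mu C < e1%:E)%E -> (mu D < e2%:E)%E -> (mu (symdiff A B) < (e1 + e2)%:E)%E.
Proof.
move=> mA mB mC mD _ sub C1 D2.
apply: (@le_lt_trans _ _ (mu (C `|` D))).
  by apply: le_measure => //; rewrite inE; [exact: msymdiff|exact: measurableU].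
apply: (le_lt_trans (measureU2 _ mC mD)).
by rewrite EFinD lteD.
Qed.

Let approximableU A B :
  approximable A -> approximable B -> approximable (A `|` B).
Proof.
move=> [mA aA] [mB aB]; split; first exact: measurableU.
move=> e e0; have e2 : 0 < e / 2 by rewrite divr_gt0.
have [U GU' AU] := aA _ e2; have [V GV BV] := aB _ e2.
exists (U `|` V); first exact: GU.
have mU := mG GU'; have mV := mG GV.
rewrite [e]splitr; apply: (lt_symdiff _ _ _ _ _ _ AU BV).
- exact: measurableU.
- exact: measurableU.
- exact: msymdiff.
- exact: msymdiff.
- exact: msymdiff.
- move=> x; rewrite /symdiff /=; tauto.
Qed.

Let approximable_bigcup (F : (set T)^nat) :
  (forall i, approximable (F i)) -> approximable (\bigcup_i F i).
Proof.
move=> aF; have mF i : measurable (F i) by case: (aF i).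
have mUF : measurable (\bigcup_i F i) by exact: bigcup_measurable.
split=> // e e0; have e2 : 0 < e / 2 by rewrite divr_gt0.
pose S n := \big[setU/set0]_(i < n.+1) F i.
have aS n : approximable (S n).
  rewrite /S; elim: n => [|n IH]; first by rewrite big_ord_recl big_ord0 setU0.
  by rewrite big_ord_recr/=; exact: approximableU.
have mS n : measurable (S n) by case: (aS n).
have SE : \bigcup_i F i = \bigcup_i S i.
  by rewrite /S bigcup_bigsetU_bigcup.
have cvS : mu (S n) @[n --> \oo] --> mu (\bigcup_i F i).
  rewrite SE; apply: nondecreasing_cvg_mu => //; first by rewrite -SE.
  by move=> a b ab; apply/subsetPset; apply: subset_bigsetU; rewrite ltnS.
have [n Hn] : exists n, (mu (\bigcup_i F i) - (e / 2)%:E < mu (S n))%E.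
  have /cvS[N _ /(_ N (leqnn N)) ?] : nbhs (mu (\bigcup_i F i))
      (fun u => mu (\bigcup_i F i) - (e / 2)%:E < u)%E; last by exists N.
  by apply: open_ereal_gt'; rewrite lteBlDr// lteDl ?lte_fin// finm.
have [_ /(_ _ e2)[U GU' SU]] := aS n; exists U => //.
have mU := mG GU'.
rewrite [e]splitr; apply: (lt_symdiff (C := (\bigcup_i F i) `\` S n) _ _ _ _ _ _ _ SU) => //.
- exact: measurableD.
- exact: msymdiff.
- exact: measurableD.
- have sub : S n `<=` \bigcup_i F i by rewrite SE; exact: bigcup_sup.
  move=> x; rewrite /symdiff /=; have := @sub x; case: (pselect (S n x)); tauto.
- have sub : S n `<=` \bigcup_i F i by rewrite SE; exact: bigcup_sup.
  rewrite measureD// ?ltey_eq ?finm//.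
  rewrite (_ : _ `&` _ = S n); last exact/setIidPr.
  by rewrite lteBlDr ?finm// addeC -lteBlDr.
Qed.

(** Approximable sets form a sigma-algebra: the error of a finite union is at
most the sum of the errors, and a countable union is a finite union up to small
measure. *)
Lemma sigma_algebra_approximable : <<s G >> `<=` approximable.
Proof.
apply: smallest_sub.
  split=> //.
  - split=> // e e0; exists set0 => //.
    by rewrite /symdiff !setD0 setU0 measure0 lte_fin.
  - by move=> A aA; rewrite setTD; exact: approximableC.
move=> A GA; split; first exact: mG.
by move=> e e0; exists A => //; rewrite /symdiff setDv setU0 measure0 lte_fin.
Qed.

End approximation_by_algebra.

(** The sets on which [nu <= mu] holds need not be stable under differences, so
there is no Dynkin class argument here.  Instead [A] is approximated, for
[mu + nu], by a member of the algebra, and the error goes to 0. *)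
Lemma le_measure_from_algebra d (T : measurableType d) (R : realType)
    (mu nu : {measure set T -> \bar R}) (G : set (set T)) :
  fin_num_fun mu -> fin_num_fun nu ->
  G `<=` measurable -> G set0 -> (forall A, G A -> G (~` A)) ->
  (forall A B, G A -> G B -> G (A `|` B)) ->
  (forall A, G A -> (nu A <= mu A)%E) ->
  forall A, <<s G >> A -> (nu A <= mu A)%E.
Proof.
move=> fmu fnu mG G0 GC GU le A sA.
pose S : {measure set T -> \bar R} := measure_add mu nu.
have SE B : S B = (mu B + nu B)%E by exact: measure_addE.
have fS : fin_num_fun S.
  by move=> B mB; rewrite SE fin_numD fmu ?fnu.
have [mA aA] := sigma_algebra_approximable fS mG G0 GC GU sA.
apply/lee_addgt0Pr => e e0; have [U GUU AU] := aA _ e0.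
have mU := mG _ GUU.
have mD1 : measurable (A `\` U) by exact: measurableD.
have mD2 : measurable (U `\` A) by exact: measurableD.
have sD : (nu (A `\` U) + mu (U `\` A) <= e%:E)%E.
  apply/ltW; apply: le_lt_trans AU.
  rewrite SE addeC; apply: leeD; apply: le_measure => //;
    rewrite ?inE //; [exact: measurableU|by right|exact: measurableU|by left].
have A1 : (nu A <= nu U + nu (A `\` U))%E.
  apply: le_trans (measureU2 _ mU mD1); apply: le_measure;
    rewrite ?inE//; [exact: measurableU|by move=> x Ax; case: (pselect (U x)); [left|right]].
have A2 : (mu U <= mu A + mu (U `\` A))%E.
  apply: le_trans (measureU2 _ mA mD2); apply: le_measure;
    rewrite ?inE//; [exact: measurableU|by move=> x Ux; case: (pselect (A x)); [left|right]].
apply: (le_trans A1); apply: (@le_trans _ _ (mu U + nu (A `\` U))%E).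
  by rewrite leeD2r// le.
apply: (@le_trans _ _ (mu A + mu (U `\` A) + nu (A `\` U))%E).
  by rewrite leeD2r.
by rewrite -addeA leeD2l// addeC.
Qed.

(** * Integrals over product measures *)

Lemma tnth_tuple_cons0 d (T : measurableType d) n (p : T * n.-tuple T) :
  tnth (tuple_cons p) ord0 = p.1.
Proof. exact: tnth0. Qed.

Lemma tnth_tuple_consS d (T : measurableType d) n (p : T * n.-tuple T) i :
  tnth (tuple_cons p) (lift ord0 i) = tnth p.2 i.
Proof. exact: tnthS. Qed.

Section product_of_functions.
Context d1 d2 (T1 : measurableType d1) (T2 : measurableType d2) (R : realType).
Variables (m1 : {sigma_finite_measure set T1 -> \bar R})
          (m2 : {sigma_finite_measure set T2 -> \bar R}).
Variables (a : T1 -> R) (b : T2 -> R).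
Hypothesis ia : m1.-integrable setT (EFin \o a).
Hypothesis ib : m2.-integrable setT (EFin \o b).

Let ma : measurable_fun setT a.
Proof. by apply/measurable_EFinP; exact: measurable_int ia. Qed.

Let mb : measurable_fun setT b.
Proof. by apply/measurable_EFinP; exact: measurable_int ib. Qed.

Let mab : measurable_fun setT (fun z : T1 * T2 => a z.1 * b z.2).
Proof.
apply: measurable_funM.
  exact: (measurableT_comp ma measurable_fst).
exact: (measurableT_comp mb measurable_snd).
Qed.

Lemma integrable_prod_mul :
  (m1 \x m2)%E.-integrable setT (fun z : T1 * T2 => (a z.1 * b z.2)%:E).
Proof.
apply/integrableP; split; first exact/measurable_EFinP.
rewrite fubini_tonelli1//=; last first.
  by apply/measurable_EFinP; exact: (measurableT_comp (@normr_measurable R setT) mab).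
rewrite /fubini_F/=.
under eq_integral => x _.
  under eq_integral => y _ do rewrite normrM EFinM.
  rewrite ge0_integralZl//=; last first.
    by apply/measurable_EFinP; exact: (measurableT_comp (@normr_measurable R setT)).
  over.
rewrite ge0_integralZr//=; last 2 first.
  - by apply/measurable_EFinP; exact: (measurableT_comp (@normr_measurable R setT)).
  - exact: integral_ge0.
have /integrableP[_ /= fa] := ia; have /integrableP[_ /= fb] := ib.
by apply: lte_mul_pinfty => //; [exact: integral_ge0|rewrite ge0_fin_numE//; exact: integral_ge0].
Qed.

Lemma integral_prod_mul :
  (\int[m1 \x m2]_z (a z.1 * b z.2)%:E =
   \int[m1]_x (a x)%:E * \int[m2]_y (b y)%:E)%E.
Proof.
rewrite -integral12_prod_meas1//; last exact: integrable_prod_mul.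
rewrite /fubini_F/=.
under eq_integral => x _.
  under eq_integral => y _ do rewrite EFinM.
  rewrite integralZl//.
  over.
have fb : (\int[m2]_y (b y)%:E)%E \is a fin_num by exact: integrable_fin_num ib.
by rewrite -(fineK fb) integralZr.
Qed.

End product_of_functions.

Section power_measure_theory.
Context d (T : measurableType d) (R : realType).
Variable mu : {sigma_finite_measure set T -> \bar R}.

Lemma integral_power_measureS n (F : n.+1.-tuple T -> \bar R) :
  measurable_fun setT F -> (forall t, 0 <= F t)%E ->
  (\int[power_measure mu n.+1]_t F t =
   \int[mu]_x \int[power_measure mu n]_t F (tuple_cons (x, t)))%E.
Proof.
move=> mF F0; rewrite /= /cons_measure.
rewrite (ge0_integral_pushforward (@measurable_tuple_cons _ T n))//.
rewrite preimage_setT fubini_tonelli1//.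
- exact: (measurableT_comp mF (@measurable_tuple_cons _ T n)).
- by move=> x; exact: F0.
Qed.

Lemma integral_power_measure_prod n (h : 'I_n -> T -> R) :
  (forall i, mu.-integrable setT (EFin \o h i)) ->
  (power_measure mu n).-integrable setT
    (fun t => (\prod_(i < n) h i (tnth t i))%:E) /\
  (\int[power_measure mu n]_t (\prod_(i < n) h i (tnth t i))%:E =
   (\prod_(i < n) fine (\int[mu]_x (h i x)%:E)%E)%:E)%E.
Proof.
elim: n h => [|n IH] h ih /=.
  have -> : (fun t : 0.-tuple T => (\prod_(i < 0) h i (tnth t i))%:E) = cst 1%:E.
    by apply/funext => t; rewrite big_ord0.
  rewrite big_ord0 integral_cst//= diracT mul1e; split=> //.
  apply/integrableP; split; first exact: measurable_cst.
  by rewrite integral_cst//= diracT mule1 normr1 ltry.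
have [iP PE] := IH (fun i => h (lift ord0 i)) (fun i => ih _).
have E p : \prod_(i < n.+1) h i (tnth (tuple_cons p) i) =
    h ord0 p.1 * \prod_(i < n) h (lift ord0 i) (tnth p.2 i).
  rewrite big_ord_recl tnth_tuple_cons0; congr (_ * _).
  by apply: eq_bigr => i _; rewrite tnth_tuple_consS.
pose F t := (\prod_(i < n.+1) h i (tnth t i))%:E.
have mF : measurable_fun setT F.
  apply/measurable_EFinP.
  apply: measurable_prod => i _; apply: measurableT_comp; last exact: measurable_tnth.
  by apply/measurable_EFinP; exact: measurable_int (ih i).
have iF : (mu \x power_measure mu n)%E.-integrable
    (@tuple_cons _ T n @^-1` setT) (F \o @tuple_cons _ T n).
  rewrite preimage_setT (_ : _ \o _ = fun z =>
    (h ord0 z.1 * \prod_(i < n) h (lift ord0 i) (tnth z.2 i))%:E).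
    exact: (integrable_prod_mul (ih ord0) iP).
  by apply/funext => z; rewrite /F /= E.
split.
  have := (integrable_pushforward (@measurable_tuple_cons _ T n) mF iF measurableT).
  exact.
rewrite /cons_measure (integral_pushforward (@measurable_tuple_cons _ T n) mF iF measurableT).
rewrite preimage_setT.
under eq_integral do rewrite /F/= E.
rewrite (integral_prod_mul (ih ord0) iP) PE big_ord_recl EFinM fineK//.
exact: integrable_fin_num (ih ord0).
Qed.

End power_measure_theory.

(** The likelihood ratio of an i.i.d. sample is the product of the individual
ratios; this is Tonelli, one observation at a time. *)
Lemma ge0_integral_power_density d (T : measurableType d) (R : realType)
    (P Q : {sigma_finite_measure set T -> \bar R}) (L : T -> R) :
  measurable_fun setT L -> (forall x, 0 <= L x) ->
  (forall A, measurable A -> Q A = (\int[P]_(x in A) (L x)%:E)%E) ->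
  forall n (Y : n.-tuple T -> \bar R),
  measurable_fun setT Y -> (forall t, 0 <= Y t)%E ->
  (\int[power_measure Q n]_t Y t =
   \int[power_measure P n]_t (Y t * (\prod_(i < n) L (tnth t i))%:E))%E.
Proof.
move=> mL L0 QE; elim=> [|n IH] Y mY Y0.
  by apply: eq_integral => t _; rewrite big_ord0 mule1.
have mYc : measurable_fun setT (Y \o @tuple_cons _ T n).
  exact: (measurableT_comp mY (@measurable_tuple_cons _ T n)).
have mprod k : measurable_fun setT (fun t : k.-tuple T => (\prod_(i < k) L (tnth t i))%:E).
  apply/measurable_EFinP; apply: measurable_prod => i _.
  by apply: measurableT_comp => //; exact: measurable_tnth.
have prod0 k (t : k.-tuple T) : (0 <= (\prod_(i < k) L (tnth t i))%:E)%E.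
  by rewrite lee_fin prodr_ge0.
rewrite integral_power_measureS//.
rewrite integral_power_measureS//; last 2 first.
  - by apply: emeasurable_funM => //; exact: mprod.
  - by move=> t; rewrite mule_ge0.
under eq_integral => x _.
  rewrite IH//; last exact: (measurableT_comp mYc (pair1_measurable x)).
  over.
pose F (z : T * n.-tuple T) := (Y (tuple_cons z) * (\prod_(i < n) L (tnth z.2 i))%:E)%E.
have mF : measurable_fun setT F.
  apply: emeasurable_funM => //.
  exact: (measurableT_comp (mprod n) measurable_snd).
have F0 z : (0 <= F z)%E by rewrite /F mule_ge0.
rewrite (ge0_integral_density mL L0 QE (h := fubini_F (power_measure P n) F)); last 2 first.
  - exact: measurable_fun_fubini_tonelli_F.
  - by move=> x; apply: integral_ge0.
apply: eq_integral => x _; rewrite /fubini_F -ge0_integralZr//; last 2 first.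
  - exact: (measurableT_comp mF (pair1_measurable x)).
  - by rewrite lee_fin.
apply: eq_integral => t _; rewrite /F /= -muleA -EFinM; congr (_ * _%:E)%E.
rewrite big_ord_recl tnth_tuple_cons0 mulrC; congr (_ * _).
by apply: eq_bigr => i _; rewrite tnth_tuple_consS.
Qed.

(** * The two-point lower bound *)

(** Arithmetic-geometric mean inequality for [min 1 z * max 1 z = z] and
[min 1 z + max 1 z = 1 + z]: the weights [4/5] and [5/16] have product [1/4], and
[39/80 = 4/5 - 5/16].  Among such weights these are nearly optimal for an
affinity of [9/10]. *)
Lemma sqrtr_le_min (R : rcfType) (z : R) : 0 <= z ->
  Num.sqrt z <= 5 / 16 * (1 + z) + 39 / 80 * Num.min 1 z.
Proof.
move=> z0; have s0 := sqrtr_ge0 z.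
have zE : z = Num.sqrt z ^+ 2 by rewrite sqr_sqrtr.
case: (leP 1 z) => _; move: s0 zE; move: (Num.sqrt z) => s s0 ->.
- have := sqr_ge0 (s - 8 / 5); nra.
- have := sqr_ge0 (s - 5 / 8); nra.
Qed.

Lemma bernoulli_ineq (R : realFieldType) (x : R) n : 0 <= x <= 1 ->
  1 - n%:R * x <= (1 - x) ^+ n.
Proof.
move=> /andP[x0 x1]; elim: n => [|n IH]; first by rewrite mul0r subr0 expr0.
rewrite exprS.
apply: (@le_trans _ _ ((1 - x) * (1 - n%:R * x))); last first.
  by rewrite ler_wpM2l// subr_ge0.
rewrite -natr1; have : 0 <= n%:R * x * x by rewrite !mulr_ge0.
nra.
Qed.

Lemma sqrtr_prod (R : rcfType) n (F : 'I_n -> R) : (forall i, 0 <= F i) ->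
  Num.sqrt (\prod_(i < n) F i) = \prod_(i < n) Num.sqrt (F i).
Proof.
move=> F0.
elim: n F F0 => [|n IH] F F0; first by rewrite !big_ord0 sqrtr1.
by rewrite !big_ord_recl sqrtrM// IH.
Qed.

Lemma measurable_sqrtr (R : realType) : measurable_fun setT (@Num.sqrt R).
Proof. by apply: continuous_measurable_fun; exact: sqrt_continuous. Qed.

Section two_point_bound.
Context d (T : measurableType d) (R : realType).
Variables (P Q : probability T R) (L : T -> R).
Hypothesis mL : measurable_fun setT L.
Hypothesis L0 : forall x, 0 <= L x.
Hypothesis QE :
  forall A, measurable A -> Q A = (\int[P]_(x in A) (L x)%:E)%E.
Variable n : nat.
Hypothesis n0 : (0 < n)%N.
Hypothesis affinity :
  ((1 - (10 * n%:R)^-1)%:E <= \int[P]_x (Num.sqrt (L x))%:E)%E.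

Let Z (t : n.-tuple T) := \prod_(i < n) L (tnth t i).

Let Z0 t : 0 <= Z t. Proof. by rewrite prodr_ge0. Qed.

Let mZ : measurable_fun setT Z.
Proof.
apply: measurable_prod => i _.
by apply: measurableT_comp => //; exact: measurable_tnth.
Qed.

Let integral_Z : (\int[power_measure P n]_t (Z t)%:E = 1)%E.
Proof.
transitivity (\int[power_measure Q n]_t cst 1 t)%E; last first.
  by rewrite integral_cst// mul1e; exact: (probability_setT (iid_law Q n)).
rewrite (ge0_integral_power_density mL L0 QE (Y := cst 1%E))//.
by apply: eq_integral => t _; rewrite mul1e.
Qed.

Let isqrtL : P.-integrable setT (fun x => (Num.sqrt (L x))%:E).
Proof.
have msL : measurable_fun setT (fun x => Num.sqrt (L x)).
  exact: (measurableT_comp (@measurable_sqrtr R) mL).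
have sL x : Num.sqrt (L x) <= 1 + L x.
  have sE := sqr_sqrtr (L0 x); have s0 := sqrtr_ge0 (L x).
  by have := sqr_ge0 (Num.sqrt (L x) - 1); nra.
apply/integrableP; split; first exact/measurable_EFinP.
apply: (@le_lt_trans _ _ (\int[P]_x (1 + (L x)%:E))%E).
  apply: ge0_le_integral => //.
  - by apply/measurable_EFinP; exact: (measurableT_comp (@normr_measurable R setT) msL).
  - by apply: emeasurable_funD => //; exact/measurable_EFinP.
  - by move=> x _; rewrite abse_EFin ger0_norm ?sqrtr_ge0// -EFinD lee_fin sL.
rewrite ge0_integralD//; last 2 first.
  - by move=> x _; rewrite lee_fin.
  - exact/measurable_EFinP.
rewrite -QE// integral_cst// mul1e probability_setT.
apply: lte_add_pinfty; last exact: ltry.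
exact: (le_lt_trans (probability_le1 P measurableT) (ltry _)).
Qed.

Let integral_sqrtZ : (\int[power_measure P n]_t (Num.sqrt (Z t))%:E =
  (fine (\int[P]_x (Num.sqrt (L x))%:E) ^+ n)%:E)%E.
Proof.
under eq_integral do rewrite /Z sqrtr_prod//.
have [_ ->] := integral_power_measure_prod (h := fun _ : 'I_n => Num.sqrt \o L)
  (fun _ => isqrtL).
by rewrite prodr_const card_ord.
Qed.

(* The affinity of the product laws is the n-th power of the affinity, at least
   [(1 - 1/(10 n))^n >= 9/10]. *)
Let integral_sqrtZ_ge : ((9 / 10)%:E <= \int[power_measure P n]_t (Num.sqrt (Z t))%:E)%E.
Proof.
rewrite integral_sqrtZ lee_fin.
have n1 : 1 <= n%:R :> R by rewrite ler1n.
have nn : (n%:R : R) != 0 by rewrite pnatr_eq0 -lt0n.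
have := @bernoulli_ineq R (10 * n%:R)^-1 n.
have -> : 1 - n%:R * (10 * n%:R)^-1 = 9 / 10 :> R by field.
have x01 : 0 <= (10 * n%:R : R)^-1 <= 1.
  apply/andP; split; first by rewrite invr_ge0 mulr_ge0.
  by rewrite invf_le1 ?mulr_gt0 ?ltr0n//; lra.
move=> /(_ x01) /le_trans; apply; apply: lerXn2r.
- by rewrite nnegrE subr_ge0; case/andP: x01.
- by rewrite nnegrE fine_ge0// integral_ge0// => x _; rewrite lee_fin sqrtr_ge0.
- by rewrite -lee_fin fineK//; exact: integrable_fin_num isqrtL.
Qed.

Let mmin : measurable_fun setT (fun t => Num.min 1 (Z t)).
Proof. exact: measurable_minr. Qed.

Let min0 t : 0 <= Num.min 1 (Z t).
Proof. by rewrite le_min ler01 Z0. Qed.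

(* Integrating [sqrtr_le_min] gives [9/10 <= 5/8 + 39/80 * E min]. *)
Let integral_min_ge :
  ((22 / 39)%:E <= \int[power_measure P n]_t (Num.min 1 (Z t))%:E)%E.
Proof.
have PnT : power_measure P n [set: n.-tuple T] = 1%E.
  exact: (probability_setT (iid_law P n)).
have : ((9 / 10)%:E <= (5 / 8)%:E +
    (39 / 80)%:E * \int[power_measure P n]_t (Num.min 1 (Z t))%:E)%E.
  apply: (le_trans integral_sqrtZ_ge).
  apply: (@le_trans _ _ (\int[power_measure P n]_t
      ((5 / 16)%:E * (1 + (Z t)%:E) + (39 / 80)%:E * (Num.min 1 (Z t))%:E))%E).
    apply: ge0_le_integral => //.
    - by apply/measurable_EFinP; exact: (measurableT_comp (@measurable_sqrtr R) mZ).
    - apply/measurable_EFinP; apply: measurable_funD.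
        by apply: measurable_funM => //; apply: measurable_funD.
      exact: measurable_funM.
    - by move=> t _; rewrite lee_fin; exact: sqrtr_le_min.
  rewrite ge0_integralD//; last 4 first.
  - by move=> t _; rewrite mule_ge0 ?adde_ge0// lee_fin.
  - by apply/measurable_EFinP; apply: measurable_funM => //; apply: measurable_funD.
  - by move=> t _; rewrite mule_ge0// lee_fin.
  - by apply/measurable_EFinP; exact: measurable_funM.
  rewrite ge0_integralZl//; last 2 first.
  - by apply: emeasurable_funD => //; exact/measurable_EFinP.
  - by move=> t _; rewrite adde_ge0// lee_fin.
  rewrite ge0_integralD//; last 2 first.
  - by move=> t _; rewrite lee_fin.
  - exact/measurable_EFinP.
  rewrite integral_Z.
  have -> : (\int[power_measure P n]_x 1 = 1)%E by rewrite integral_cst// mul1e.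
  rewrite ge0_integralZl//; last 2 first.
  - exact/measurable_EFinP.
  - by move=> t _; rewrite lee_fin.
  by rewrite leeD2r// -EFinD -EFinM lee_fin; lra.
case: (\int[_]_t _)%E => [x||].
- by rewrite -EFinM -EFinD !lee_fin; lra.
- by rewrite leey.
- by rewrite gt0_muleNy ?lte_fin// addeNy.
Qed.

(** The maximum of the two risks is at least half their sum, and
[|S - a| * Z + |S - b| >= min 1 Z * |a - b|] by the triangle inequality, where
[Z] is the likelihood ratio of the sample. *)
Lemma two_point_risk (S : n.-tuple T -> R) (a b : R) :
  measurable_fun setT S ->
  ((11 / 39 * `|a - b|)%:E <= maxe 'E_(iid_law Q n)[fun X => `|S X - a|%R]
                                   'E_(iid_law P n)[fun X => `|S X - b|%R])%E.
Proof.
move=> mS.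
have mabs c : measurable_fun setT (fun t => `|S t - c|).
  by apply: (measurableT_comp (@normr_measurable R setT)); exact: measurable_funB.
set Ea := ('E_(iid_law Q n)[_])%E; set Eb := ('E_(iid_law P n)[_])%E.
have EaE : (Ea = \int[power_measure P n]_t (`|S t - a| * Z t)%:E)%E.
  rewrite /Ea unlock (ge0_integral_power_density mL L0 QE)//.
  exact/measurable_EFinP.
have EbE : (Eb = \int[power_measure P n]_t `|S t - b|%:E)%E by rewrite /Eb unlock.
have le_sum : ((22 / 39 * `|a - b|)%:E <= Ea + Eb)%E.
  rewrite EaE EbE -ge0_integralD//; last 3 first.
  - by move=> t _; rewrite lee_fin mulr_ge0.
  - by apply/measurable_EFinP; exact: measurable_funM.
  - exact/measurable_EFinP.
  apply: (@le_trans _ _ (\int[power_measure P n]_t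
      ((Num.min 1 (Z t))%:E * `|a - b|%:E))%E).
    rewrite ge0_integralZr//; last 2 first.
    - exact/measurable_EFinP.
    - by move=> t _; rewrite lee_fin.
    by rewrite EFinM lee_wpmul2r.
  apply: ge0_le_integral => //.
  - by move=> t _; rewrite mule_ge0// lee_fin.
  - by apply/measurable_EFinP; exact: measurable_funM.
  - apply/measurable_EFinP; apply: measurable_funD => //.
    exact: measurable_funM.
  - move=> t _; rewrite -EFinM -EFinD lee_fin.
    have : `|a - b| <= `|S t - a| + `|S t - b|.
      by rewrite (distrC (S t) a) (le_trans _ (ler_normD _ _))// subrKA.
    have := normr_ge0 (S t - a); have := normr_ge0 (S t - b).
    have := Z0 t; case: (leP 1 (Z t)); nra.
rewrite leNgt gt_max; apply/negP => /andP[lta ltb].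
have := lteD lta ltb; apply/negP; rewrite -leNgt; apply: le_trans le_sum.
by rewrite -EFinD lee_fin; lra.
Qed.

End two_point_bound.

(** * The one-dimensional perturbation *)

Section quadratic_pieces.
Variable R : realType.
Implicit Types p q al be ga t : R.
Local Notation leb := (@lebesgue_measure R).

(** Every one-dimensional function below is a sum of at most two such pieces, so that
all the integrals reduce to one computation. *)
Definition quad_piece p q al be ga t : R :=
  if p <= t < q then al * t ^+ 2 + be * t + ga else 0.

Let quad al be ga : {poly R} := al *: 'X^2 + be *: 'X + ga%:P.
Let primitive al be ga : {poly R} :=
  (al / 3) *: 'X^3 + (be / 2) *: 'X^2 + ga *: 'X.

Let quadE al be ga t : (quad al be ga).[t] = al * t ^+ 2 + be * t + ga.
Proof. by rewrite /quad !hornerE. Qed.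

Let deriv_primitive al be ga : (primitive al be ga)^`() = quad al be ga.
Proof.
rewrite /primitive /quad !derivD !derivZ !derivXn derivX /=.
rewrite -(scaler_nat 3 'X^2) -(scaler_nat 2 'X^1) !scalerA !divfK ?pnatr_eq0// expr1.
by rewrite alg_polyC.
Qed.

Let quad_pieceE p q al be ga :
  quad_piece p q al be ga = horner (quad al be ga) \_ `[p, q[.
Proof.
apply/funext => t; rewrite /patch /quad_piece quadE mem_setE in_itv.
by [].
Qed.

Let within_quad p q al be ga :
  {within `[p, q], continuous (horner (quad al be ga))}.
Proof. by apply: continuous_subspaceT; exact: continuous_horner. Qed.

Let integrable_quad p q al be ga :
  leb.-integrable `[p, q[ (EFin \o horner (quad al be ga)).
Proof.
apply: (@integrableS _ _ _ leb `[p, q]) => //.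
  by apply: subset_itvl; rewrite bnd_simp.
by apply: continuous_compact_integrable;
  [exact: segment_compact|exact: within_quad].
Qed.

Lemma integrable_quad_piece p q al be ga :
  leb.-integrable setT (EFin \o quad_piece p q al be ga).
Proof.
rewrite quad_pieceE.
have mI : measurable (`[p, q[%classic : set (measurableTypeR R)) by [].
have := (@integrable_mkcond _ _ R leb `[p, q[%classic
  (EFin \o horner (quad al be ga)) mI).1 (integrable_quad p q al be ga).
by congr (_.-integrable _ _); apply/funext => t; rewrite /patch/=; case: ifP.
Qed.

Lemma Rintegral_quad_piece p q al be ga : p <= q ->
  \int[leb]_t quad_piece p q al be ga t =
  al / 3 * (q ^+ 3 - p ^+ 3) + be / 2 * (q ^+ 2 - p ^+ 2) + ga * (q - p).
Proof.
rewrite le_eqVlt => /predU1P[->|pq].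
  rewrite (_ : quad_piece _ _ _ _ _ = cst 0).
    by rewrite Rintegral_cst// mul0r !subrr !mulr0 !addr0.
  by apply/funext => t; rewrite /quad_piece/= le_lt_asym.
rewrite quad_pieceE -Rintegral_mkcond Rintegral_itv_bndo_bndc//.
pose F := primitive al be ga.
rewrite /Rintegral (@continuous_FTC2 _ (horner (quad al be ga)) (horner F))//.
- rewrite -EFinB /F /primitive !hornerE/=; lra.
- split.
  + by move=> t _; exact: derivable_horner.
  + by apply: cvg_at_right_filter; exact: continuous_horner.
  + by apply: cvg_at_left_filter; exact: continuous_horner.
- move=> t _; rewrite derive1E.
  by rewrite (@derive_val _ _ _ _ _ _ _ (is_derive_poly F t)) /F deriv_primitive.
Qed.

End quadratic_pieces.

Section two_pieces.
Variable R : realType.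
Implicit Types p m n q : R.
Local Notation leb := (@lebesgue_measure R).

Definition two_pieces p m al be ga n q al' be' ga' t : R :=
  quad_piece p m al be ga t + quad_piece n q al' be' ga' t.

Lemma integrable_two_pieces p m al be ga n q al' be' ga' :
  leb.-integrable setT (EFin \o two_pieces p m al be ga n q al' be' ga').
Proof.
have := integrableD measurableT (integrable_quad_piece p m al be ga)
  (integrable_quad_piece n q al' be' ga').
by congr (_.-integrable _ _); apply/funext => t.
Qed.

Lemma Rintegral_two_pieces p m al be ga n q al' be' ga' : p <= m -> n <= q ->
  \int[leb]_t two_pieces p m al be ga n q al' be' ga' t =
  (al / 3 * (m ^+ 3 - p ^+ 3) + be / 2 * (m ^+ 2 - p ^+ 2) + ga * (m - p)) +
  (al' / 3 * (q ^+ 3 - n ^+ 3) + be' / 2 * (q ^+ 2 - n ^+ 2) + ga' * (q - n)).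
Proof.
move=> pm nq; rewrite RintegralD//; last 2 first.
- exact: integrable_quad_piece.
- exact: integrable_quad_piece.
by rewrite !Rintegral_quad_piece.
Qed.

End two_pieces.

Section one_dimensional_bump.
Variables (R : realType) (a h : R).
Hypothesis h0 : 0 < h.
Local Notation leb := (@lebesgue_measure R).

(** The lengths [h] and [h / 7] make the integral of the step zero, so that its
tail integral, the tent ([Rintegral_step_tail]), has compact support. *)
Definition step := two_pieces (a - h) a 0 0 (-1) a (a + h / 7) 0 0 7.
Definition tent :=
  two_pieces (a - h) a 0 1 (h - a) a (a + h / 7) 0 (-7) (h + 7 * a).

Ltac split_pieces t :=
  have ? := h0; rewrite /step /tent /two_pieces /quad_piece ?(leNgt a t);
  case: (leP (a - h) t) => ?; case: (ltP t a) => ?;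
  try (exfalso; lra); case: (ltP t (a + h / 7)) => ? /=; try (exfalso; lra).

Lemma step_bounds t : -1 <= step t <= 7.
Proof. by split_pieces t; apply/andP; split; lra. Qed.

Lemma step_out t : ~~ (a - h <= t < a + h / 7) -> step t = 0.
Proof.
by split_pieces t => //= _; lra.
Qed.

Lemma tent_bounds t : 0 <= tent t <= h.
Proof. by split_pieces t; apply/andP; split; lra. Qed.

Lemma tent_out t : ~~ (a - h <= t < a + h / 7) -> tent t = 0.
Proof. by split_pieces t => //= _; lra. Qed.

Lemma tent_peak : tent a = h.
Proof. by split_pieces a; lra. Qed.

Lemma integrable_tent : leb.-integrable setT (EFin \o tent).
Proof. exact: integrable_two_pieces. Qed.

Lemma Rintegral_tent : \int[leb]_t tent t = 4 / 7 * h ^+ 2.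
Proof. by have hpos := h0; rewrite Rintegral_two_pieces; [field|lra|lra]. Qed.

Let tent_sqrE : (fun t => tent t ^+ 2) =
  two_pieces (a - h) a 1 (2 * (h - a)) ((h - a) ^+ 2)
             a (a + h / 7) 49 (- 14 * (h + 7 * a)) ((h + 7 * a) ^+ 2).
Proof. by apply/funext => t; split_pieces t; ring. Qed.

Lemma integrable_tent_sqr : leb.-integrable setT (fun t => (tent t ^+ 2)%:E).
Proof.
rewrite (_ : (fun _ => _) = EFin \o (fun t => tent t ^+ 2))//.
by rewrite tent_sqrE; exact: integrable_two_pieces.
Qed.

Lemma Rintegral_tent_sqr : \int[leb]_t (tent t ^+ 2) = 8 / 21 * h ^+ 3.
Proof. by have hpos := h0; rewrite tent_sqrE Rintegral_two_pieces; [field|lra|lra]. Qed.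

Let mulr_stepE : (fun t => t * step t) =
  two_pieces (a - h) a 0 (-1) 0 a (a + h / 7) 0 7 0.
Proof. by apply/funext => t; split_pieces t; ring. Qed.

Lemma integrable_mulr_step : leb.-integrable setT (fun t => (t * step t)%:E).
Proof.
rewrite (_ : (fun _ => _) = EFin \o (fun t => t * step t))//.
by rewrite mulr_stepE; exact: integrable_two_pieces.
Qed.

(** An instance of Fubini's theorem for [step t] on the region [x <= t], the
step having integral zero; here the explicit values are compared. *)
Lemma Rintegral_mulr_step : \int[leb]_t (t * step t) = \int[leb]_t tent t.
Proof. by have hpos := h0; rewrite mulr_stepE !Rintegral_two_pieces; [field|lra..]. Qed.

Let step_tailE (x : R) : exists p m n q, [/\ p <= m, n <= q,
  (fun t => (x <= t)%R%:R * step t) = two_pieces p m 0 0 (-1) n q 0 0 7 &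
  tent x = 7 * (q - n) - (m - p)].
Proof.
have hpos := h0; case: (leP x (a - h)) => x1; last case: (leP x a) => x2;
  last case: (leP x (a + h / 7)) => x3.
- exists (a - h), a, a, (a + h / 7); split; [lra|lra| |by split_pieces x; lra].
  by apply/funext => t; rewrite /step /two_pieces /quad_piece;
    case: (leP x t) => ?; split_pieces t; lra.
- exists x, a, a, (a + h / 7); split; [lra|lra| |by split_pieces x; lra].
  by apply/funext => t; rewrite /step /two_pieces /quad_piece;
    case: (leP x t) => ?; split_pieces t; lra.
- exists a, a, x, (a + h / 7); split; [lra|lra| |by split_pieces x; lra].
  by apply/funext => t; rewrite /step /two_pieces /quad_piece;
    case: (leP x t) => ?; split_pieces t; lra.
- exists a, a, a, a; split; [lra|lra| |by split_pieces x; lra].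
  by apply/funext => t; rewrite /step /two_pieces /quad_piece;
    case: (leP x t) => ?; split_pieces t; lra.
Qed.

Lemma integrable_step_tail x :
  leb.-integrable setT (fun t => ((x <= t)%R%:R * step t)%:E).
Proof.
have [p [m [n [q [_ _ E _]]]]] := step_tailE x.
rewrite (_ : (fun _ => _) = EFin \o (fun t => (x <= t)%R%:R * step t))//.
by rewrite E; exact: integrable_two_pieces.
Qed.

Lemma Rintegral_step_tail x :
  \int[leb]_t ((x <= t)%R%:R * step t) = tent x.
Proof.
have [p [m [n [q [pm nq E ->]]]]] := step_tailE x.
by rewrite E Rintegral_two_pieces//; ring.
Qed.

End one_dimensional_bump.

(** * Lebesgue measure on row vectors *)

Section lebesgue_rV_theory.
Variables (R : realType) (d : nat).
Local Notation leb := (@lebesgue_measure R).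

Lemma measurable_coord (i : 'I_d) :
  measurable_fun [set: 'rV[R]_d] (fun x => x ord0 i : measurableTypeR R).
Proof.
move=> _ A mA; rewrite setTI; apply: sub_sigma_algebra.
rewrite -bigcup_seq/=; exists i => /=; first by rewrite mem_index_enum.
by exists A => //; rewrite setTI.
Qed.

Lemma integral_lebesgue_rV_prod (h : 'I_d -> R -> R) :
  (forall i, leb.-integrable setT (EFin \o h i)) ->
  lebesgue_rV.-integrable [set: 'rV[R]_d]
    (fun x => (\prod_(i < d) h i (x ord0 i))%:E) /\
  (\int[@lebesgue_rV R d]_x (\prod_(i < d) h i (x ord0 i))%:E =
   (\prod_(i < d) \int[leb]_t h i t)%:E)%E.
Proof.
move=> ih; have [iP PE] := integral_power_measure_prod ih.
pose F (x : 'rV[R]_d) := (\prod_(i < d) h i (x ord0 i))%:E.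
have mF : measurable_fun setT F.
  apply/measurable_EFinP; apply: measurable_prod => i _.
  apply: (measurableT_comp _ (measurable_coord i)).
  by apply/measurable_EFinP; exact: measurable_int (ih i).
have E : F \o @row_of_tuple R d = fun t => (\prod_(i < d) h i (tnth t i))%:E.
  apply/funext => t; rewrite /F /= /row_of_tuple; congr EFin.
  by apply: eq_bigr => i _; rewrite mxE.
have iF : (power_measure leb d).-integrable
    (@row_of_tuple R d @^-1` setT) (F \o @row_of_tuple R d).
  by rewrite preimage_setT E.
split.
  exact: (integrable_pushforward (@measurable_row_of_tuple R d) mF iF measurableT).
rewrite /lebesgue_rV (integral_pushforward (@measurable_row_of_tuple R d) mF iF measurableT).
by rewrite preimage_setT E.
Qed.

End lebesgue_rV_theory.

(** * Comparison of measures on the cells of a grid *)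

Section grid_comparison.
Variables (R : realType) (d : nat) (lo : 'I_d -> R) (w : R).
Hypothesis w0 : 0 < w.
Implicit Types (N : nat) (x y : 'rV[R]_d).

Definition cube : set 'rV[R]_d :=
  [set x | forall i, lo i <= x ord0 i < lo i + w].

Definition mesh N : R := w / 2 ^+ N.

Definition grid_index N x (i : 'I_d) : int :=
  Num.floor ((x ord0 i - lo i) / mesh N).

Definition grid_cell N (k : 'I_d -> nat) : set 'rV[R]_d :=
  [set x | forall i, lo i + (k i)%:R * mesh N <= x ord0 i
                     < lo i + (k i)%:R * mesh N + mesh N].

(** On the cube, such a set is a union of cells of the grid of mesh
[w / 2 ^ N].  Asking nothing outside the cube makes complements and unions
immediate. *)
Definition saturated N (A : set 'rV[R]_d) :=
  forall x y, cube x -> cube y -> grid_index N x =1 grid_index N y -> A x -> A y.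

Definition grid_algebra (A : set 'rV[R]_d) :=
  measurable A /\ exists N, saturated N A.

Let mesh_gt0 N : 0 < mesh N.
Proof. by rewrite divr_gt0// exprn_gt0. Qed.

(* The dyadic grids are nested: [n <= floor t] is the same as
   [2 ^ k * n <= floor (2 ^ k * t)]. *)
Let grid_index_refine N M x y : (N <= M)%N ->
  grid_index M x =1 grid_index M y -> grid_index N x =1 grid_index N y.
Proof.
move=> NM xy i.
have key z (n : int) : (n <= grid_index N z i) =
    (n * (2 ^+ (M - N))%:Z <= grid_index M z i).
  rewrite /grid_index !floor_ge_int /mesh !invf_div !mulrA.
  have -> : 2 ^+ M = 2 ^+ (M - N) * 2 ^+ N :> R by rewrite -exprD subnK.
  rewrite intrM -[X in _ = (X <= _)]mulrC.
  rewrite [X in _ = (_ <= X)](_ : _ = (2 ^+ (M - N)) * ((z ord0 i - lo i) * 2 ^+ N / w)).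
    rewrite (_ : ((2 ^+ (M - N))%:Z)%:~R = 2 ^+ (M - N)).
      by rewrite ler_pM2l// exprn_gt0.
    by rewrite rmorphXn rmorphXn.
  by rewrite [_ * (_ * 2 ^+ N)]mulrCA -!mulrA.
apply/eqP; rewrite eq_le; apply/andP; split.
  by rewrite key -xy -key.
by rewrite key xy -key.
Qed.

Let saturatedW N M A : (N <= M)%N -> saturated N A -> saturated M A.
Proof. by move=> NM sA x y Bx By xy; apply: sA => //; exact: grid_index_refine xy. Qed.

Let grid_algebra0 : grid_algebra set0.
Proof. by split=> //; exists 0%N. Qed.

Let grid_algebraC A : grid_algebra A -> grid_algebra (~` A).
Proof.
move=> [mA [N sA]]; split; first exact: measurableC.
by exists N => x y Bx By xy nAx Ay; apply: nAx; apply: sA Ay => // i; rewrite xy.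
Qed.

Let grid_algebraU A B : grid_algebra A -> grid_algebra B -> grid_algebra (A `|` B).
Proof.
move=> [mA [N sA]] [mB [M sB]]; split; first exact: measurableU.
exists (maxn N M) => x y Bx By xy [Ax|Bx'].
- by left; apply: (saturatedW (leq_maxl N M) sA) Ax.
- by right; apply: (saturatedW (leq_maxr N M) sB) Bx'.
Qed.

(* The threshold is approached from below by grid points. *)
Let half_space_sigma (i : 'I_d) (t : R) :
  <<s grid_algebra >> [set x | x ord0 i < t].
Proof.
pose tt N := lo i + (Num.floor ((t - lo i) / mesh N))%:~R * mesh N.
have tt_le N : tt N <= t.
  rewrite /tt -lerBrDl -ler_pdivlMr//; by rewrite -floor_ge_int.
have lt_tt N : t - mesh N < tt N.
  have : (t - lo i) / mesh N < (Num.floor ((t - lo i) / mesh N) + 1)%:~R.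
    by rewrite -floor_lt_int ltrDl.
  by rewrite ltr_pdivrMr// intrD mulrDl mul1r /tt => ?; lra.
have E : [set x : 'rV[R]_d | x ord0 i < t] =
    \bigcup_N [set x | x ord0 i < tt N].
  apply/seteqP; split=> x /=; last by move=> [N _] /lt_le_trans; apply; exact: tt_le.
  move=> xt.
  have [N HN] : exists N, mesh N < t - x ord0 i.
    have xt0 : 0 < t - x ord0 i by rewrite subr_gt0.
    pose N := (Num.truncn (w / (t - x ord0 i))).+1.
    exists N; rewrite /mesh ltr_pdivrMr ?exprn_gt0// mulrC -ltr_pdivrMr//.
    apply: (@lt_le_trans _ _ N%:R); first exact: truncnS_gt.
    by rewrite -natrX ler_nat ltnW// ltn_expl.
  by exists N => //=; have := lt_tt N; lra.
rewrite [X in <<s _ >> X]E.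
apply: sigma_algebra_bigcup => N; apply: sub_sigma_algebra; split.
  have := @measurable_coord R d i measurableT `]-oo, (tt N)[%classic
    (measurable_itv _).
  by rewrite setTI; congr (measurable _); apply/seteqP; split=> x /=; rewrite in_itv.
exists N => x y _ _ /(_ i); rewrite /grid_index /=.
have key z : (z < tt N) = (Num.floor ((z - lo i) / mesh N) <
    Num.floor ((t - lo i) / mesh N)).
  by rewrite floor_lt_int ltr_pdivrMr// ltrBlDl.
by rewrite !key => ->.
Qed.

Lemma sigma_grid_algebra : measurable `<=` <<s grid_algebra >>.
Proof.
apply: smallest_sub; first exact: smallest_sigma_algebra.
move=> A; rewrite -bigcup_seq => -[i _ [C mC <-]].
pose T := g_sigma_algebraType grid_algebra.
have : measurable_fun [set: T] (fun x : T => (x : 'rV[R]_d) ord0 i : measurableTypeR R).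
  apply: (measurability _ (RGenInftyO.measurableE R)) => //.
  move=> _ [_ [t ->] <-]; rewrite setTI.
  by have := half_space_sigma i t; congr (_ _); apply/seteqP; split=> x /=; rewrite in_itv.
by move=> /(_ measurableT C mC).
Qed.

Let cell_index N (k : 'I_d -> nat) x : grid_cell N k x ->
  forall i, grid_index N x i = (k i)%:Z.
Proof.
move=> kx i; have /andP[x1 x2] := kx i; apply: floor_def.
rewrite intrD ler_pdivlMr// ltr_pdivrMr// mulrDl mul1r -!pmulrn.
by apply/andP; split; lra.
Qed.

Let cube_cell N x : cube x ->
  exists k : {ffun 'I_d -> 'I_(2 ^ N)}, grid_cell N (fun i => k i) x.
Proof.
move=> Bx.
have u0 i : 0 <= (x ord0 i - lo i) / mesh N.
  by have /andP[x1 _] := Bx i; rewrite divr_ge0 ?subr_ge0// (ltW (mesh_gt0 _)).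
have idx i : (Num.truncn ((x ord0 i - lo i) / mesh N) < 2 ^ N)%N.
  have /andP[x1 x2] := Bx i.
  rewrite -(ltr_nat R); apply: (@le_lt_trans _ _ ((x ord0 i - lo i) / mesh N)).
    by have /andP[] := truncn_itv (u0 i).
  by rewrite ltr_pdivrMr// /mesh natrX mulrC divfK ?expf_neq0// ltrBlDl.
exists [ffun i => Ordinal (idx i)] => i; rewrite ffunE /=.
have /andP[k1 k2] := truncn_itv (u0 i).
rewrite ler_pdivlMr// in k1; rewrite ltr_pdivrMr// -natr1 mulrDl mul1r in k2.
by apply/andP; split; lra.
Qed.

Let measurable_cell N (k : 'I_d -> nat) : measurable (grid_cell N k).
Proof.
have -> : grid_cell N k = \big[setI/setT]_(i < d)
    ((fun x : 'rV[R]_d => x ord0 i : measurableTypeR R) @^-1`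
     `[lo i + (k i)%:R * mesh N, lo i + (k i)%:R * mesh N + mesh N[).
  rewrite -bigcap_seq/=; apply/seteqP; split=> x /= kx.
    by move=> i _ /=; rewrite in_itv; exact: kx.
  by move=> i; have := kx i; rewrite /= in_itv; apply; rewrite mem_index_enum.
apply: bigsetI_measurable => i _.
by rewrite -[X in measurable X]setTI; exact: measurable_coord.
Qed.

Let measurable_cube : measurable cube.
Proof.
have := measurable_cell 0%N (fun=> 0%N); congr (measurable _).
by apply/seteqP; split=> x /= cx i; have := cx i; rewrite mul0r addr0 /mesh expr0 divr1.
Qed.

Lemma le_measure_grid (mu nu : {measure set 'rV[R]_d -> \bar R}) :
  fin_num_fun mu -> fin_num_fun nu -> nu (~` cube) = 0%E ->
  (forall N (k : 'I_d -> nat), (forall i, (k i < 2 ^ N)%N) ->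
    (nu (grid_cell N k) <= mu (grid_cell N k))%E) ->
  forall A, measurable A -> (nu A <= mu A)%E.
Proof.
move=> fmu fnu nuC le A /sigma_grid_algebra; move: A.
apply: (le_measure_from_algebra fmu fnu) => //; first by move=> A [].
move=> A [mA [N sA]].
pose K := [set k : {ffun 'I_d -> 'I_(2 ^ N)} | grid_cell N (fun i => k i) `&` A `&` cube !=set0].
pose cells := \bigcup_(k in K) grid_cell N (fun i => k i).
have cell_cube (k : {ffun 'I_d -> 'I_(2 ^ N)}) : grid_cell N (fun i => k i) `<=` cube.
  move=> x kx i; have /andP[x1 x2] := kx i; have m0 := mesh_gt0 N.
  have : 0 <= (k i)%:R * mesh N by rewrite mulr_ge0// ltW.
  have : (k i).+1%:R * mesh N <= w.
    by rewrite /mesh mulrA ler_pdivrMr ?exprn_gt0// mulrC ler_pM2l// -natrX ler_nat.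
  by rewrite -natr1 mulrDl mul1r => ? ?; apply/andP; split; lra.
have AE : A `&` cube = cells.
  apply/seteqP; split=> x.
    move=> [Ax Bx]; have [k kx] := cube_cell N Bx.
    by exists k => //; exists x.
  move=> [k [y [[ky Ay] By]] kx]; split; last exact: cell_cube kx.
  apply: (sA y) => //; first exact: cell_cube kx.
  by move=> i; rewrite (cell_index ky) (cell_index kx).
have tK : trivIset K (fun k : {ffun 'I_d -> 'I_(2 ^ N)} => grid_cell N (fun i => k i)).
  move=> k k' _ _ [x [kx k'x]]; apply/ffunP => i; apply/val_inj.
  have := cell_index k'x i; rewrite (cell_index kx i) => /eqP.
  by rewrite eqz_nat => /eqP.
have mAc : measurable (A `&` cube) by exact: measurableI.
apply: (@le_trans _ _ (mu (A `&` cube))); last first.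
  by apply: le_measure; rewrite ?inE//; exact: subIsetl.
apply: (@le_trans _ _ (nu (A `&` cube))).
  rewrite (measureDI _ mA measurable_cube).
  rewrite [X in (X + _)%E](_ : _ = 0%E) ?add0e//.
  apply: (subset_measure0 (B := ~` cube)) => //; first exact: measurableD.
  exact: measurableC.
have fK : finite_set K by exact: finite_finset.
rewrite AE /cells !measure_fin_bigcup//.
by apply: lee_fsum => // k _; apply: le => i; exact: ltn_ord.
Qed.

End grid_comparison.

(** * An iterated mean value theorem *)

Section iterated_mean_value.
Variables (R : realType) (d : nat).
Implicit Types (g : 'rV[R]_d -> R) (x y : 'rV[R]_d) (s : seq 'I_d) (i j : 'I_d).
Local Notation e_ i := (delta_mx ord0 i : 'rV[R]_d).

Definition nabla (l : R) i g x : R := g x - g (x + l *: e_ i).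
Definition iter_nabla l s g : 'rV[R]_d -> R := foldr (nabla l) g s.

Lemma iter_nabla_comm l s j g :
  iter_nabla l s (nabla l j g) = nabla l j (iter_nabla l s g).
Proof.
elim: s => //= i s IH; rewrite /iter_nabla/= -/(iter_nabla l s _) IH.
apply/funext => x; rewrite /nabla /iter_nabla/= -/(iter_nabla l s g).
rewrite -!addrA (addrC (l *: e_ i)); lra.
Qed.

Lemma iter_partial_exists_rcons (A : set 'rV[R]_d) s j g :
  iter_partial_exists A (rcons s j) g ->
  iter_partial_exists A s (partial j g) /\
  forall x, A x -> derivable g x (e_ j).
Proof.
elim: s => [|i s IH] /=; first by move=> [_ dg]; split.
move=> [/IH[es dg] di]; split; last exact: dg.
split; first exact: es.
move=> x Ax; by have := di x Ax; rewrite /iter_partial foldr_rcons.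
Qed.

Lemma coord_shift x l i j : (x + l *: e_ i) ord0 j = x ord0 j + l * (i == j)%:R.
Proof. by rewrite !mxE eqxx eq_sym. Qed.

Section in_box.
Variables (lo hi : 'I_d -> R) (l : R).
Hypothesis l0 : 0 < l.

Definition closed_box : set 'rV[R]_d :=
  [set x | forall i, lo i <= x ord0 i <= hi i].

Let fits s x := forall i, lo i <= x ord0 i <= hi i - (i \in s)%:R * l.

Let fits_box s x : fits s x -> closed_box x.
Proof.
move=> fx i; have /andP[-> /=] := fx i; move/le_trans; apply.
by rewrite gerBl mulr_ge0// ltW.
Qed.

Let fits_cons i s x : i \notin s -> fits (i :: s) x ->
  fits s x /\ fits s (x + l *: e_ i).
Proof.
move=> ins fx; split=> j.
  have /andP[-> /=] := fx j; move/le_trans; apply.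
  rewrite lerD2l lerN2 ler_pM2r// ler_nat inE.
  by case: (j == i) => //=; case: (_ \in _).
rewrite coord_shift; have /andP[x1 x2] := fx j; move: x2; rewrite inE.
have [ij|ij] := eqVneq i j.
  rewrite -ij (negbTE ins) /= mul1r mulr1 mul0r => x2; subst j.
  by have lp := l0; apply/andP; split; lra.
by rewrite /= mulr0n mulr0 addr0 => x2; rewrite x1.
Qed.

Lemma derivable_shift g x c v : derivable g (x + c) v ->
  derivable (fun y => g (y + c)) x v /\
  'D_v (fun y => g (y + c)) x = 'D_v g (x + c).
Proof.
rewrite /derivable /derive.
have -> : (fun h : R => h^-1 *: ((fun y => g (y + c)) (h *: v + x) - (fun y => g (y + c)) x)) =
  (fun h : R => h^-1 *: (g (h *: v + (x + c)) - g (x + c))).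
  by apply/funext => h; rewrite addrA.
by [].
Qed.

Let derivable_iter_nabla s j g x : uniq s ->
  (forall y, closed_box y -> derivable g y (e_ j)) -> fits s x ->
  derivable (iter_nabla l s g) x (e_ j) /\
  partial j (iter_nabla l s g) x = iter_nabla l s (partial j g) x.
Proof.
move=> us dg; elim: s us x => [|i s IH] /= us x fx.
  by split=> //; apply: dg; exact: fits_box fx.
case/andP: us => ins us.
have [fx1 fx2] := fits_cons ins fx.
have [d1 e1] := IH us _ fx1; have [d2 e2] := IH us _ fx2.
have [d3 e3] := derivable_shift d2.
rewrite /iter_nabla/= -/(iter_nabla l s g) -/(iter_nabla l s _).
have E : nabla l i (iter_nabla l s g) = iter_nabla l s g -
    (fun y => iter_nabla l s g (y + l *: e_ i)) by [].
rewrite E; split; first exact: derivableB d1 d3.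
by rewrite /partial (deriveB d1 d3) e3 /nabla -e1 -e2.
Qed.

Lemma is_derive_line g x v (t : R) : derivable g (x + t *: v) v ->
  is_derive t (1 : R) (fun u : R => g (x + u *: v)) ('D_v g (x + t *: v)).
Proof.
move=> dg.
have E : (fun h : R => h^-1 *: ((fun u : R => g (x + u *: v)) (h *: 1 + t) -
      (fun u : R => g (x + u *: v)) t)) =
    (fun h : R => h^-1 *: (g (h *: v + (x + t *: v)) - g (x + t *: v))).
  apply/funext => h; congr (_ *: (g _ - _)).
  by rewrite scalerDl -[h *: 1]/(h * 1) mulr1 addrCA.
apply: DeriveDef.
- by rewrite /derivable E.
- by rewrite /derive E.
Qed.

(** The innermost derivative, in direction [j], is treated first: differences
commute, so the one in direction [j] can be taken last, and the ordinary mean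
value theorem along a line replaces it by the derivative of the other
differences, which are the differences of the partial derivative in direction
[j]. *)
Lemma iter_nabla_mean_value s g x : uniq s ->
  iter_partial_exists closed_box s g -> fits s x ->
  exists2 y, closed_box y &
    iter_nabla l s g x = (- l) ^+ size s * iter_partial s g y.
Proof.
elim/last_ind: s g x => [|s j IH] g x us eg fx.
  by exists x; [exact: fits_box fx|rewrite expr0 mul1r].
rewrite rcons_uniq in us; case/andP: us => js us.
have [es dg] := iter_partial_exists_rcons eg.
have fxj : fits (j :: s) x by move=> i; have := fx i; rewrite mem_rcons.
pose F := iter_nabla l s g.
have fline (t : R) : 0 <= t <= l -> fits s (x + t *: e_ j).
  move=> /andP[t0 tl] i; have /andP[x1 x2] := fxj i.
  move: x2; rewrite coord_shift inE.
  have [ij|ij] := eqVneq j i.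
    rewrite -ij (negbTE js) /= mul1r mulr1 mul0r => x2; subst i.
    by have lp := l0; apply/andP; split; lra.
  by rewrite /= mulr0n mulr0 addr0 => x2; rewrite x1.
have dF (t : R) : 0 <= t <= l ->
    is_derive t (1 : R) (fun u : R => F (x + u *: e_ j)) (partial j F (x + t *: e_ j)).
  by move=> /fline ft; apply: is_derive_line; have [] := derivable_iter_nabla us dg ft.
have [t tl Ft] : exists2 t, t \in `]0, l[ &
    F (x + l *: e_ j) - F (x + 0 *: e_ j) = partial j F (x + t *: e_ j) * (l - 0).
  apply: (@MVT R (fun u : R => F (x + u *: e_ j))) => //.
  - move=> t; rewrite in_itv/= => /andP[t0 tl].
    by apply: dF; rewrite !ltW.
  - apply: derivable_within_continuous => t; rewrite in_itv/= => t0l.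
    by have [] := dF _ t0l.
have t0l : 0 <= t <= l by move: tl; rewrite in_itv/= => /andP[? ?]; rewrite !ltW.
have [y by' Ey] := IH _ _ us es (fline _ t0l).
exists y => //.
rewrite /iter_nabla foldr_rcons -/(iter_nabla l s _) iter_nabla_comm /nabla -/F.
rewrite size_rcons exprS /iter_partial foldr_rcons -/(iter_partial s _).
have [_ e] := derivable_iter_nabla us dg (fline _ t0l).
move: Ft; rewrite scale0r addr0 subr0 /F e Ey => Ft.
rewrite -opprB Ft; ring.
Qed.

End in_box.
End iterated_mean_value.

(** * The mixing measure divided by the volume *)

Lemma measurable_invr (R : realType) : measurable_fun setT (@GRing.inv R).
Proof.
rewrite (_ : @GRing.inv R = fun t => t * (t ^+ 2) `^ (-1)).
  apply: measurable_funM => //.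
  exact: (measurableT_comp (measurable_powR _) (exprn_measurable _)).
apply/funext => t; rewrite powR_inv1 ?sqr_ge0//.
have [->|t0] := eqVneq t 0; first by rewrite invr0 mul0r.
by rewrite expr2 invfM mulrA divff// mul1r.
Qed.

Section mixing_measure_near_a_point.
Variables (R : realType) (d : nat) (lo : 'I_d -> R).
Hypothesis lo0 : forall i, 0 < lo i.
Variables (G : probability 'rV[R]_d R) (f : 'rV[R]_d -> R).
Hypothesis fE : forall x, f x = smu_mixture G x.
Implicit Types (x v : 'rV[R]_d) (s : seq 'I_d).

Definition above : set 'rV[R]_d := [set v | forall i, lo i <= v ord0 i].
Definition volume v : R := \prod_(i < d) v ord0 i.
(** Cutting off away from the boundary of the orthant keeps the weight bounded,
hence the weighted mixing measure finite. *)
Definition inv_volume_above v : R := \1_above v * (volume v)^-1.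

Lemma measurable_rV_forall (P : 'I_d -> set R) :
  (forall i, measurable (P i : set (measurableTypeR R))) ->
  measurable [set v : 'rV[R]_d | forall i, P i (v ord0 i)].
Proof.
move=> mP; rewrite [X in measurable X](_ : _ = \big[setI/setT]_(i < d)
    ((fun x : 'rV[R]_d => x ord0 i : measurableTypeR R) @^-1` P i)).
  apply: bigsetI_measurable => i _.
  by rewrite -[X in measurable X]setTI; apply: measurable_coord => //; exact: mP.
rewrite -bigcap_seq/=; apply/seteqP; split=> x /= kx.
  by move=> i _ /=; exact: kx.
by move=> i; apply: kx; rewrite /= mem_index_enum.
Qed.

Lemma measurable_volume : measurable_fun setT volume.
Proof. by apply: measurable_prod => i _; exact: measurable_coord. Qed.

Lemma measurable_inv_volume : measurable_fun setT (fun v => (volume v)^-1).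
Proof. exact: (measurableT_comp (@measurable_invr R) measurable_volume). Qed.

Lemma measurable_above : measurable above.
Proof.
have := @measurable_rV_forall (fun i => [set t | lo i <= t]); apply.
move=> i; rewrite (_ : [set t | _] = `[lo i, +oo[%classic)//.
by apply/seteqP; split=> t /=; rewrite in_itv/= andbT.
Qed.

Lemma volume_above v : above v -> \prod_(i < d) lo i <= volume v.
Proof. by move=> va; apply: ler_prod => i _; rewrite ltW//= va. Qed.

Let prod_lo0 : 0 < \prod_(i < d) lo i.
Proof. exact: prodr_gt0. Qed.

Lemma inv_volume_above_ge0 v : 0 <= inv_volume_above v.
Proof.
rewrite /inv_volume_above indicE; case: (boolP (v \in above)) => [/[!inE] va|_];
  rewrite ?mul0r// mul1r.
by rewrite invr_ge0 (le_trans _ (volume_above va))// ltW.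
Qed.

Lemma measurable_inv_volume_above : measurable_fun setT inv_volume_above.
Proof.
apply: measurable_funM; last exact: measurable_inv_volume.
exact: measurable_indic measurable_above.
Qed.

Lemma inv_volume_above_le v : inv_volume_above v <= (\prod_(i < d) lo i)^-1.
Proof.
rewrite /inv_volume_above indicE; case: (boolP (v \in above)) => [/[!inE] va|_].
  rewrite mul1r lef_pV2 ?posrE//; first exact: volume_above.
  by apply: lt_le_trans (volume_above va).
by rewrite mul0r invr_ge0 ltW.
Qed.

Definition scaled_mixing : {measure set 'rV[R]_d -> \bar R} :=
  wmeasure G measurable_inv_volume_above inv_volume_above_ge0.

Lemma scaled_mixing_fin : fin_num_fun scaled_mixing.
Proof.
apply: wmeasure_fin_num_fun.
apply: (@le_lt_trans _ _ (\int[G]_x ((\prod_(i < d) lo i)^-1)%:E)%E).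
  apply: ge0_le_integral => //.
  - by move=> x _; rewrite lee_fin inv_volume_above_ge0.
  - by apply/measurable_EFinP; exact: measurable_inv_volume_above.
  - by move=> x _; rewrite lee_fin inv_volume_above_le.
by rewrite integral_cst//= probability_setT mule1 ltry.
Qed.

(** Bounded in the coordinates listed in [s] only: going from [s] to [i :: s]
subtracts a translate, which is how the iterated differences arise. *)
Definition slab l s x : set 'rV[R]_d :=
  [set v | forall i, x ord0 i <= v ord0 i /\ (i \in s -> v ord0 i < x ord0 i + l)].

Lemma measurable_slab l s x : measurable (slab l s x).
Proof.
have := @measurable_rV_forall (fun i =>
  [set t | x ord0 i <= t /\ (i \in s -> t < x ord0 i + l)]); apply.
move=> i; case: (boolP (i \in s)) => _.
- rewrite (_ : [set t | _] = `[x ord0 i, x ord0 i + l[%classic)//.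
  apply/seteqP; split=> t /=; rewrite in_itv/=.
    by move=> [-> ->].
  by move=> /andP[].
- rewrite (_ : [set t | _] = `[x ord0 i, +oo[%classic)//.
  apply/seteqP; split=> t /=; rewrite in_itv/= andbT//.
  by move=> [->].
Qed.

Lemma scaled_mixing_upper x : above x -> scaled_mixing (slab 0 [::] x) = (f x)%:E.
Proof.
move=> ax; rewrite fE /smu_mixture.
have x0 i : 0 < x ord0 i by exact: lt_le_trans (ax i).
rewrite /Rintegral [X in fine X](_ : _ = scaled_mixing (slab 0 [::] x)).
  by rewrite fineK// scaled_mixing_fin//; exact: measurable_slab.
rewrite /scaled_mixing /= /wmeasure [LHS]integral_mkcond [RHS]integral_mkcond.
apply: eq_integral => v _; rewrite /patch.
case: (boolP (v \in slab 0 [::] x)) => [/[!inE] xv|/negP/[!inE] xv].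
  have vx i : x ord0 i <= v ord0 i by have [] := xv i.
  have -> : v \in orthant.
    by rewrite inE => i; exact: lt_le_trans (vx i).
  rewrite /inv_volume_above !indicE mem_set; last by move=> i; rewrite x0 vx.
  by rewrite mem_set ?mulr1 ?mul1r// => i; exact: le_trans (vx i).
case: ifPn => // vo; rewrite indicE memNset ?mulr0// => lb.
by apply: xv => i; have /andP[] := lb i.
Qed.

(** The slab for [i :: s] is the slab for [s] minus its translate by [l] in
direction [i], so the measure of a cell is an alternating sum of values of the
mixture, the values themselves being the measures of the orthants above a
point. *)
Lemma scaled_mixing_slab l s x : 0 < l -> uniq s -> above x ->
  scaled_mixing (slab l s x) = (iter_nabla l s f x)%:E.
Proof.
move=> l0; elim: s x => [|i s IH] x /=.
  move=> _ ax; rewrite -scaled_mixing_upper//; congr (scaled_mixing _).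
  by apply/seteqP; split=> v xv j; have [] := xv j.
move=> /andP[ins us] ax.
have axl : above (x + l *: delta_mx ord0 i).
  move=> j; apply: (le_trans (ax j)); rewrite coord_shift lerDl.
  by rewrite mulr_ge0// ltW.
rewrite /nabla EFinB -IH// -IH//.
have fin y : scaled_mixing (slab l s y) \is a fin_num.
  by apply: scaled_mixing_fin; exact: measurable_slab.
have sub : slab l s (x + l *: delta_mx ord0 i) `<=` slab l s x.
  move=> v xv j; have [] := xv j; rewrite coord_shift => v1 v2.
  split; first by apply: le_trans v1; rewrite lerDl mulr_ge0// ltW.
  move=> js; have := v2 js; have [ij|_] := eqVneq i j; last by rewrite mulr0n mulr0 addr0.
  by move: ins; rewrite ij js.
rewrite [X in (X - _)%E](_ : _ = (scaled_mixing (slab l (i :: s) x) +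
    scaled_mixing (slab l s (x + l *: delta_mx ord0 i)))%E).
  by rewrite addeK.
rewrite -measureU//; last first.
- apply/seteqP; split=> // v [v1 v2].
  have [_ /(_ (mem_head _ _))] := v1 i; have [] := v2 i.
  by rewrite coord_shift eqxx mulr1 => ? _ ?; lra.
- exact: measurable_slab.
- exact: measurable_slab.
congr (scaled_mixing _); apply/seteqP; split=> v; last first.
  move=> [xv|/sub//] j; have [v1 v2] := xv j; split=> // js.
  by apply: v2; rewrite inE js orbT.
move=> xv; case: (ltP (v ord0 i) (x ord0 i + l)) => vi; [left|right] => j.
  have [v1 v2] := xv j; split=> //; rewrite inE => /predU1P[->//|].
  exact: v2.
have [v1 v2] := xv j; rewrite coord_shift; have [ij|_] := eqVneq i j.
  by rewrite -ij mulr1; split=> //; rewrite (negbTE ins).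
by rewrite mulr0n mulr0 addr0.
Qed.

End mixing_measure_near_a_point.

(** * The mixing measure dominates Lebesgue measure near the point *)

Section product_weights.
Variables (R : realType) (d : nat).
Implicit Types (g : 'I_d -> R -> R) (v : 'rV[R]_d).
Local Notation leb := (@lebesgue_measure R).

Definition prod_weight g v : R := \prod_(i < d) g i (v ord0 i).

Lemma measurable_prod_weight g :
  (forall i, leb.-integrable setT (EFin \o g i)) -> measurable_fun setT (prod_weight g).
Proof.
move=> ig; apply/measurable_EFinP.
by have [/measurable_int] := integral_lebesgue_rV_prod ig.
Qed.

Lemma integral_prod_weight g (c : R) :
  (forall i, leb.-integrable setT (EFin \o g i)) ->
  (\int[@lebesgue_rV R d]_v (c * prod_weight g v)%:E =
   (c * \prod_(i < d) \int[leb]_t g i t)%:E)%E.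
Proof.
move=> ig; have [iP PE] := integral_lebesgue_rV_prod ig.
under eq_integral do rewrite EFinM.
by rewrite integralZl// PE EFinM.
Qed.

Lemma integrable_prod_weight g (c : R) :
  (forall i, leb.-integrable setT (EFin \o g i)) ->
  lebesgue_rV.-integrable [set: 'rV[R]_d] (fun v => (c * prod_weight g v)%:E).
Proof.
move=> ig; have [iP PE] := integral_lebesgue_rV_prod ig.
exact: (integrableZl measurableT c iP).
Qed.

End product_weights.

Section domination.
Variables (R : realType) (d : nat) (lo : 'I_d -> R) (w kappa : R).
Hypotheses (lo0 : forall i, 0 < lo i) (w0 : 0 < w) (kappa0 : 0 <= kappa).
Variables (G : probability 'rV[R]_d R) (f : 'rV[R]_d -> R).
Hypothesis fE : forall x, f x = smu_mixture G x.
Let box := closed_box lo (fun i => lo i + w).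
Hypothesis fex : mixed_partial_exists box f.
Hypothesis fmix : forall y, box y -> kappa <= (-1) ^+ d * mixed_partial f y.
Local Notation leb := (@lebesgue_measure R).

Definition cube_piece (i : 'I_d) : R -> R := quad_piece (lo i) (lo i + w) 0 0 1.
Definition cube_weight (v : 'rV[R]_d) : R := kappa * prod_weight cube_piece v.

Lemma cube_piece_ge0 i t : 0 <= cube_piece i t.
Proof. by rewrite /cube_piece /quad_piece; case: ifP => // _; rewrite !mul0r !add0r. Qed.

Lemma cube_weight_ge0 v : 0 <= cube_weight v.
Proof. by rewrite mulr_ge0// prodr_ge0// => i _; exact: cube_piece_ge0. Qed.

Lemma measurable_cube_weight : measurable_fun setT cube_weight.
Proof.
apply: measurable_funM => //; apply: measurable_prod_weight => i.
exact: integrable_quad_piece.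
Qed.

Definition cube_measure : {measure set 'rV[R]_d -> \bar R} :=
  wmeasure lebesgue_rV measurable_cube_weight cube_weight_ge0.

Lemma cube_measure_fin : fin_num_fun cube_measure.
Proof.
apply: wmeasure_fin_num_fun.
by rewrite integral_prod_weight ?ltry// => i; exact: integrable_quad_piece.
Qed.

Let cube_measureC : cube_measure (~` cube lo w) = 0%E.
Proof.
rewrite /cube_measure /= /wmeasure.
apply: integral0_eq => v nv; rewrite /cube_weight /prod_weight.
have [i vi] : exists i, ~~ (lo i <= v ord0 i < lo i + w).
  apply/existsP; rewrite -negb_forall; apply/negP => /forallP H.
  by apply: nv => i.
by rewrite (bigD1 i)//= {1}/cube_piece /quad_piece (negbTE vi) mul0r mulr0.
Qed.

Let corner N (k : 'I_d -> nat) : 'rV[R]_d := \row_i (lo i + (k i)%:R * mesh w N).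

Let cell_slab N k : grid_cell lo w N k = slab (mesh w N) (enum 'I_d) (corner N k).
Proof.
apply/seteqP; split=> v kv i; have := kv i; rewrite mxE mem_enum/=.
  by move=> /andP[].
by move=> [-> /(_ isT) ->].
Qed.

Let cell_sub_cube N k : (forall i, (k i < 2 ^ N)%N) ->
  forall i, lo i + (k i)%:R * mesh w N + mesh w N <= lo i + w.
Proof.
move=> kN i; rewrite -addrA lerD2l -{2}[mesh w N]mul1r -mulrDl natr1.
by rewrite /mesh mulrA ler_pdivrMr ?exprn_gt0// mulrC ler_pM2l// -natrX ler_nat.
Qed.

Let mesh_gt0 N : 0 < mesh w N.
Proof. by rewrite divr_gt0// exprn_gt0. Qed.

Let cube_measure_cell N k : (forall i, (k i < 2 ^ N)%N) ->
  cube_measure (grid_cell lo w N k) = (kappa * mesh w N ^+ d)%:E.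
Proof.
move=> kN; have m0 := mesh_gt0 N.
pose c i := lo i + (k i)%:R * mesh w N.
pose g (i : 'I_d) := quad_piece (c i) (c i + mesh w N) 0 0 1.
have clo i : lo i <= c i by rewrite lerDl mulr_ge0// ltW.
transitivity (\int[lebesgue_rV]_v (kappa * prod_weight g v)%:E)%E.
  rewrite /cube_measure /= /wmeasure integral_mkcond; apply: eq_integral => v _.
  rewrite /patch /cube_weight; case: (boolP (v \in _)) => [/[!inE] kv|/negP/[!inE] kv].
    congr (_ * _)%:E; apply: eq_bigr => i _; have /andP[v1 v2] := kv i.
    have := cell_sub_cube kN i; have := clo i; rewrite /c in v1 v2 * => ? ?.
    rewrite /cube_piece /g /quad_piece !ifT//; apply/andP; split; rewrite /c; lra.
  have [i vi] : exists i, ~~ (c i <= v ord0 i < c i + mesh w N).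
    apply/existsP; rewrite -negb_forall; apply/negP => /forallP H.
    by apply: kv => i; exact: H.
  by rewrite /prod_weight (bigD1 i)//= {1}/g /quad_piece (negbTE vi) mul0r mulr0.
rewrite integral_prod_weight; last by move=> i; exact: integrable_quad_piece.
congr (_ * _)%:E; rewrite (eq_bigr (fun=> mesh w N)).
  by rewrite prodr_const card_ord.
move=> i _; rewrite Rintegral_quad_piece; last by rewrite lerDl ltW.
by rewrite !mul0r !add0r mul1r addrAC subrr add0r.
Qed.

(** Cell by cell this is the iterated mean value theorem and the lower bound
[kappa] on the signed mixed derivative. *)
Lemma cube_measure_le A : measurable A -> (cube_measure A <= scaled_mixing lo0 G A)%E.
Proof.
apply: (le_measure_grid w0 (scaled_mixing_fin lo0 G) cube_measure_fin cube_measureC) => N k kN.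
have m0 := mesh_gt0 N.
rewrite cube_measure_cell// cell_slab.
have alo : above lo (corner N k).
  by move=> i; rewrite mxE lerDl mulr_ge0// ltW.
rewrite (scaled_mixing_slab lo0 fE m0 (enum_uniq _) alo).
have [|y yb ->] := @iter_nabla_mean_value R d lo (fun i => lo i + w) (mesh w N) m0
  (enum 'I_d) f (corner N k) (enum_uniq _) fex.
  move=> i; rewrite alo mem_enum/= mul1r lerBrDr mxE.
  exact: cell_sub_cube.
rewrite lee_fin size_enum_ord exprNn -/(mixed_partial f) mulrAC.
by rewrite ler_pM2r ?exprn_gt0// fmix.
Qed.

End domination.

(** * The perturbed density *)

Lemma quad_piece_scale (R : realType) (p q t : R) :
  quad_piece p q 0 1 0 t = t * quad_piece p q 0 0 1 t.
Proof. by rewrite /quad_piece; case: ifP => _; ring. Qed.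

(** If the product is negative, one factor lies between [-1] and [0] and the others are at
most [M] in absolute value. *)
Lemma prod_ge_Nexp (R : realType) n (F : 'I_n -> R) (M : R) : 1 <= M -> (0 < n)%N ->
  (forall i, -1 <= F i <= M) -> - M ^+ n.-1 <= \prod_(i < n) F i.
Proof.
move=> M1 n0 FM.
have M0 : 0 <= M by rewrite (le_trans _ M1).
case: (boolP [exists i, F i < 0]) => [/existsP[i Fi]|].
  rewrite (bigD1 i)//=.
  have [Fi1 _] := andP (FM i).
  have : `|\prod_(j < n | j != i) F j| <= M ^+ n.-1.
    rewrite normr_prod; apply: (@le_trans _ _ (\prod_(j < n | j != i) M)).
      apply: ler_prod => j _; rewrite normr_ge0 ler_norml/=.
      by have /andP[? ?] := FM j; apply/andP; split=> //; lra.
    rewrite prodr_const (_ : #|_| = n.-1)//.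
    by rewrite -[in RHS](card_ord n) (cardC1 i).
  move: (\prod_(j < n | j != i) F j) (M ^+ n.-1) => x y.
  rewrite ler_norml => /andP[? ?]; nra.
rewrite negb_exists => /forallP H; apply: (@le_trans _ _ 0).
  by rewrite oppr_le0 exprn_ge0.
by apply: prodr_ge0 => i _; rewrite leNgt H.
Qed.

Section perturbation.
Variables (R : realType) (d : nat) (a : 'rV[R]_d) (h kappa : R).
Hypotheses (d0 : (0 < d)%N) (h0 : 0 < h) (kappa0 : 0 <= kappa).
Let lo (i : 'I_d) := a ord0 i - h.
Hypothesis lo0 : forall i, 0 < lo i.
Variables (f : density R d) (G : probability 'rV[R]_d R).
Hypothesis GO : G orthant = 1%E.
Hypothesis fE : forall x, f x = smu_mixture G x.
Let w := 2 * h.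
Let box := closed_box lo (fun i => lo i + w).
Hypothesis fex : mixed_partial_exists box f.
Hypothesis fmix : forall y, box y -> kappa <= (-1) ^+ d * mixed_partial f y.
Local Notation leb := (@lebesgue_measure R).
Implicit Types (x v : 'rV[R]_d).

(** The factor [7 ^ (d - 1)] is the largest absolute value of a negative product
of steps: dividing by it makes the signed density at least [- kappa]. *)
Definition bump_height : R := kappa * (7 ^+ d.-1)^-1.
Definition tent_bump x : R := bump_height * prod_weight (fun i => tent (a ord0 i) h) x.
Definition bump_mass : R := bump_height * (4 / 7 * h ^+ 2) ^+ d.

Let w0 : 0 < w. Proof. by rewrite mulr_gt0. Qed.
Let c0 : 0 <= bump_height.
Proof. by rewrite mulr_ge0// invr_ge0 exprn_ge0. Qed.

Lemma bump_mass_ge0 : 0 <= bump_mass.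
Proof. by rewrite mulr_ge0// exprn_ge0// mulr_ge0// sqr_ge0. Qed.

Lemma bump_ge0 x : 0 <= tent_bump x.
Proof.
by rewrite mulr_ge0// prodr_ge0// => i _; have /andP[] := tent_bounds (a ord0 i) h0 (x ord0 i).
Qed.

Lemma bump_out x : ~ box x -> tent_bump x = 0.
Proof.
move=> xb; rewrite /tent_bump /prod_weight.
have [i xi] : exists i, ~~ (a ord0 i - h <= x ord0 i < a ord0 i + h / 7).
  apply/existsP; rewrite -negb_forall; apply/negP => /forallP H.
  apply: xb => i; have /andP[? ?] := H i; have hp := h0; rewrite /lo /w.
  by apply/andP; split; lra.
by rewrite (bigD1 i)//= tent_out// mul0r mulr0.
Qed.

Lemma bump_peak : tent_bump a = bump_height * h ^+ d.
Proof.
congr (_ * _); rewrite /prod_weight (eq_bigr (fun=> h)) ?prodr_const ?card_ord//.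
by move=> i _; exact: tent_peak.
Qed.

Lemma measurable_bump : measurable_fun setT tent_bump.
Proof.
apply: measurable_funM => //; apply: measurable_prod_weight => i.
exact: integrable_tent.
Qed.

Lemma integral_bump : (\int[@lebesgue_rV R d]_x (tent_bump x)%:E = bump_mass%:E)%E.
Proof.
rewrite integral_prod_weight; last by move=> i; exact: integrable_tent.
congr (_ * _)%:E; rewrite (eq_bigr (fun=> 4 / 7 * h ^+ 2)).
  by rewrite prodr_const card_ord.
by move=> i _; exact: Rintegral_tent.
Qed.

Lemma integral_bump_sqr : (\int[@lebesgue_rV R d]_x (tent_bump x ^+ 2)%:E =
  (bump_height ^+ 2 * (8 / 21 * h ^+ 3) ^+ d)%:E)%E.
Proof.
transitivity (\int[@lebesgue_rV R d]_x (bump_height ^+ 2 *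
    prod_weight (fun i t => tent (a ord0 i) h t ^+ 2) x)%:E)%E.
  by apply: eq_integral => x _; rewrite /tent_bump exprMn /prod_weight prodrXl.
rewrite integral_prod_weight; last by move=> i; exact: integrable_tent_sqr.
congr (_ * _)%:E; rewrite (eq_bigr (fun=> 8 / 21 * h ^+ 3)).
  by rewrite prodr_const card_ord.
by move=> i _; exact: Rintegral_tent_sqr.
Qed.

Let mass_piece (i : 'I_d) : R -> R := quad_piece (lo i) (lo i + w) 0 1 0.
(* The perturbed mixing measure removes the weight [removed], which is [kappa]
   times the volume on the cube, and adds [removed + signed], which is
   nonnegative.  Two nonnegative weights avoid subtracting a signed one. *)
Let removed v : R := kappa * prod_weight mass_piece v.
Let signed v : R := bump_height * prod_weight (fun i t => t * step (a ord0 i) h t) v.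
Let added v : R := removed v + signed v.

Let removedE v : removed v = cube_weight lo w kappa v * volume v.
Proof.
rewrite /removed /cube_weight -mulrA; congr (_ * _).
rewrite /prod_weight /volume -big_split/=; apply: eq_bigr => i _.
by rewrite /mass_piece quad_piece_scale mulrC.
Qed.

Let cube_weight_out v : ~ orthant v -> cube_weight lo w kappa v = 0.
Proof.
move=> vO; rewrite /cube_weight /prod_weight.
have [i vi] : exists i, ~~ (0 < v ord0 i).
  by apply/existsP; rewrite -negb_forall; apply/negP => /forallP.
rewrite (bigD1 i)//= {1}/cube_piece /quad_piece ifF ?mul0r ?mulr0//.
apply/negP => /andP[lv _]; move: vi; rewrite -leNgt => /(le_trans lv).
by rewrite leNgt lo0.
Qed.

Let signedE v : signed v = removed v * (7 ^+ d.-1)^-1 * \prod_(i < d) step (a ord0 i) h (v ord0 i).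
Proof.
rewrite /signed /removed /bump_height -!mulrA; congr (_ * _).
rewrite [RHS]mulrCA; congr (_ * _).
rewrite /prod_weight -big_split/=; apply: eq_bigr => i _.
rewrite /mass_piece quad_piece_scale.
case: (boolP (a ord0 i - h <= v ord0 i < a ord0 i + h / 7)) => vi; last first.
  by rewrite step_out// !mulr0.
rewrite /quad_piece ifT; first by ring.
by have hp := h0; rewrite /lo /w; case/andP: vi => ? ?; apply/andP; split; lra.
Qed.

Let removed_ge0 v : 0 <= removed v.
Proof.
rewrite mulr_ge0// prodr_ge0// => i _; rewrite /mass_piece /quad_piece.
case: ifP => // /andP[v1 _]; rewrite mul0r add0r mul1r addr0.
by rewrite (le_trans _ v1)// ltW.
Qed.

Let added_ge0 v : 0 <= added v.
Proof.
rewrite /added signedE -mulrA -{1}[removed v]mulr1 -mulrDr mulr_ge0//.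
have p0 : 0 < (7 ^+ d.-1 : R) by rewrite exprn_gt0.
have := @prod_ge_Nexp R d (fun i => step (a ord0 i) h (v ord0 i)) 7.
rewrite ler1n => /(_ isT d0 (fun i => step_bounds _ h0 _)).
rewrite -[X in 0 <= X + _](mulVf (lt0r_neq0 p0)) -mulrDr => ?.
by apply: mulr_ge0; [rewrite invr_ge0 ltW|rewrite -lerBlDl sub0r].
Qed.

Let measurable_removed : measurable_fun setT removed.
Proof.
apply: measurable_funM => //; apply: measurable_prod_weight => i.
exact: integrable_quad_piece.
Qed.

Let measurable_signed : measurable_fun setT signed.
Proof.
apply: measurable_funM => //; apply: measurable_prod_weight => i.
exact: integrable_mulr_step.
Qed.

Let measurable_added : measurable_fun setT added.
Proof. exact: measurable_funD. Qed.

Let removed_measure : {measure set 'rV[R]_d -> \bar R} :=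
  wmeasure lebesgue_rV measurable_removed removed_ge0.
Let added_measure : {measure set 'rV[R]_d -> \bar R} :=
  wmeasure lebesgue_rV measurable_added added_ge0.

Let integrable_removed :
  lebesgue_rV.-integrable setT (fun v => (removed v)%:E).
Proof. by apply: integrable_prod_weight => i; exact: integrable_quad_piece. Qed.

Let removed_measure_fin : fin_num_fun removed_measure.
Proof.
apply: wmeasure_fin_num_fun.
by rewrite integral_prod_weight ?ltry// => i; exact: integrable_quad_piece.
Qed.

Let G_fin : fin_num_fun G.
Proof. by move=> A mA; exact: fin_num_measure. Qed.

(* [cube_measure_le] multiplied by the volume. *)
Let removed_measure_le A : measurable A -> (removed_measure A <= G A)%E.
Proof.
move=> mA.
pose g v := (\1_A v * `|volume v|)%:E.
have mg : measurable_fun setT g.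
  apply/measurable_EFinP; apply: measurable_funM; first exact: measurable_indic.
  exact: (measurableT_comp (@normr_measurable R setT) (@measurable_volume R d)).
have g0 v : (0 <= g v)%E by rewrite lee_fin mulr_ge0.
have cmeas := measurable_cube_weight lo w kappa.
pose ncw := cube_weight_ge0 lo w kappa0.
have -> : removed_measure A = (\int[cube_measure lo w kappa0]_v g v)%E.
  rewrite /cube_measure ge0_integral_wmeasure//.
  rewrite /removed_measure /= /wmeasure integral_mkcond; apply: eq_integral => v _.
  rewrite /patch /g indicE; case: (boolP (v \in A)) => vA; last by rewrite mul0r mul0e.
  rewrite mul1r -EFinM; congr EFin.
  have := removed_ge0 v; rewrite removedE mulrC => vc0.
  rewrite -{2}(ger0_norm (ncw v)) -normrM ger0_norm//.
apply: (@le_trans _ _ (\int[scaled_mixing lo0 G]_v g v)%E).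
  apply: ge0_le_integral_measure => //.
  - exact: scaled_mixing_fin.
  - exact: cube_measure_fin.
  - by move=> B mB; exact: (cube_measure_le lo0 w0 kappa0 fE fex fmix mB).
rewrite /scaled_mixing ge0_integral_wmeasure//.
rewrite -[G A]mul1e -integral_cst//= [leRHS]integral_mkcond.
apply: ge0_le_integral => //.
- by move=> v _; rewrite mule_ge0// lee_fin inv_volume_above_ge0.
- apply: emeasurable_funM => //; apply/measurable_EFinP.
  exact: measurable_inv_volume_above.
- by apply/(measurable_restrictT _ mA); exact: measurable_cst.
- move=> v _; rewrite /g /patch indicE.
  case: (boolP (v \in A)) => vA; last by rewrite mul0r mul0e.
  rewrite mul1r -EFinM lee_fin /inv_volume_above indicE.
  case: (boolP (v \in above lo)) => [/[!inE] va|_]; last by rewrite mul0r mulr0.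
  have v0 : 0 < volume v by apply: lt_le_trans (volume_above lo0 va); exact: prodr_gt0.
  by rewrite mul1r gtr0_norm// divff// gt_eqF.
Qed.

Let M : {measure set 'rV[R]_d -> \bar R} :=
  measure_add (mdiff G_fin removed_measure_fin removed_measure_le) added_measure.

(* In additive form, so as not to ask for the finiteness of the integral
   against the removed measure. *)
Let integral_M (g : 'rV[R]_d -> \bar R) : measurable_fun setT g ->
  (forall v, 0 <= g v)%E ->
  (\int[M]_v g v + \int[removed_measure]_v g v = \int[G]_v g v + \int[added_measure]_v g v)%E.
Proof.
move=> mg g0.
rewrite (ge0_integral_mdiff G_fin removed_measure_fin removed_measure_le mg g0) /M.
by rewrite (ge0_integral_measure_add _ _ measurableT)// addeAC.
Qed.

Let M_setT : M setT = (1 + bump_mass)%:E.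
Proof.
have := integral_M (measurable_cst 1%E) (fun=> lee01).
rewrite !integral_cst// !mul1e.
rewrite [X in (_ = X + _)%E -> _](_ : _ = 1%E); last exact: (probability_setT G).
have m2E : added_measure setT = (removed_measure setT + bump_mass%:E)%E.
  rewrite /added_measure /removed_measure /= /wmeasure -/removed /added.
  under eq_integral do rewrite EFinD.
  rewrite integralD//; last first.
    by apply: integrable_prod_weight => i; exact: integrable_mulr_step.
  congr (_ + _)%E; rewrite integral_prod_weight; last first.
    by move=> i; exact: integrable_mulr_step.
  congr (_ * _)%:E; rewrite (eq_bigr (fun=> 4 / 7 * h ^+ 2)).
    by rewrite prodr_const card_ord.
  by move=> i _; rewrite Rintegral_mulr_step// Rintegral_tent.
rewrite m2E => E.
have fin1 : removed_measure setT \is a fin_num by exact: removed_measure_fin.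
by rewrite -[LHS](addeK (x := removed_measure setT))// E (addeC (removed_measure setT)) addeA addeK.
Qed.

Definition perturbed_mixing : probability 'rV[R]_d R := mnormalize M G.

Let perturbed_mixingE A : perturbed_mixing A = ((1 + bump_mass)^-1%:E * M A)%E.
Proof.
rewrite /perturbed_mixing /= /mnormalize M_setT /=.
have mp : 0 < 1 + bump_mass by rewrite ltr_pwDl// bump_mass_ge0.
rewrite ifF; first by rewrite muleC.
by rewrite eqe gt_eqF//= orbF.
Qed.

Let integral_perturbed_mixing (g : 'rV[R]_d -> \bar R) : measurable_fun setT g ->
  (forall v, 0 <= g v)%E ->
  (\int[perturbed_mixing]_v g v = (1 + bump_mass)^-1%:E * \int[M]_v g v)%E.
Proof.
move=> mg g0.
have r0 : 0 <= (1 + bump_mass)^-1 by rewrite invr_ge0 addr_ge0// bump_mass_ge0.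
rewrite -(ge0_integral_mscale M measurableT (NngNum r0))//.
by apply: eq_measure_integral => A mA _; exact: perturbed_mixingE.
Qed.

Lemma perturbed_mixing_orthant : perturbed_mixing orthant = 1%E.
Proof.
have mO : measurable (@orthant R d).
  have := @measurable_rV_forall R d (fun i => [set t | 0 < t]); apply.
  move=> i; rewrite (_ : [set t | _] = `]0, +oo[%classic)//.
  by apply/seteqP; split=> t /=; rewrite in_itv/= andbT.
have m2C : added_measure (~` orthant) = 0%E.
  rewrite /added_measure /= /wmeasure; apply: integral0_eq => v vO.
  have -> : added v = 0; last by [].
  have r0 : removed v = 0 by rewrite removedE cube_weight_out// mul0r.
  by rewrite /added signedE r0 !mul0r addr0.
have GC : G (~` orthant) = 0%E by rewrite probability_setC// GO subee.
have MC : M (~` orthant) = 0%E.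
  have ME B : M B = (mdiff G_fin removed_measure_fin removed_measure_le B + added_measure B)%E.
    exact: measure_addE.
  apply/eqP; rewrite eq_le measure_ge0 andbT ME m2C adde0.
  have -> : 0%E = G (~` orthant) by [].
  rewrite (mdiffE G_fin removed_measure_fin removed_measure_le) ?leeDl//; exact: measurableC.
have := probability_setC perturbed_mixing (measurableC mO).
by rewrite setCK => ->; rewrite perturbed_mixingE MC mule0 sube0.
Qed.

Let smu_mixture_out (P : probability 'rV[R]_d R) x : ~ orthant x -> smu_mixture P x = 0.
Proof.
move=> xO; rewrite /smu_mixture /Rintegral integral0_eq// => v _.
rewrite indicE memNset ?mulr0// => lb.
by apply: xO => i; have /andP[] := lb i.
Qed.

Section mixture_in_orthant.
Variable x : 'rV[R]_d.
Hypothesis xO : orthant x.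

Let up : set 'rV[R]_d := [set v | forall i, x ord0 i <= v ord0 i].

Let mup : measurable up.
Proof. exact: (@measurable_above R d (fun i => x ord0 i)). Qed.

(* Cutting off at [x] itself is the indicator of the [v] whose box contains
   [x]. *)
Let kernel v : R := inv_volume_above (fun i => x ord0 i) v.

Let kernel0 v : 0 <= kernel v. Proof. exact: inv_volume_above_ge0. Qed.

Let mkernel : measurable_fun setT kernel.
Proof. exact: measurable_inv_volume_above. Qed.

Let smu_kernel (P : probability 'rV[R]_d R) :
  smu_mixture P x = fine (\int[P]_v (kernel v)%:E)%E.
Proof.
rewrite /smu_mixture /Rintegral; congr fine; rewrite [LHS]integral_mkcond.
apply: eq_integral => v _; rewrite /patch /kernel /inv_volume_above !indicE.
case: (boolP (v \in above (fun i => x ord0 i))) => [/[!inE] xv|/negP/[!inE] xv].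
  rewrite mem_set; last by move=> i; exact: lt_le_trans (xv i).
  by rewrite mem_set ?mulr1 ?mul1r// => i; rewrite xO xv.
case: ifPn => _; rewrite ?mul0r// memNset ?mulr0// => lb.
by apply: xv => i; have /andP[] := lb i.
Qed.

Let integral_kernel : (\int[G]_v (kernel v)%:E = (f x)%:E)%E.
Proof.
rewrite fE smu_kernel fineK// ge0_fin_numE; last by apply: integral_ge0 => v _; rewrite lee_fin.
apply: (@le_lt_trans _ _ (\int[G]_v ((\prod_(i < d) x ord0 i)^-1)%:E)%E).
  apply: ge0_le_integral => //.
  - by move=> v _; rewrite lee_fin.
  - exact/measurable_EFinP.
  - by move=> v _; rewrite lee_fin inv_volume_above_le.
rewrite integral_cst//= [X in (_ * X)%E](_ : _ = 1%E) ?mule1 ?ltry//.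
exact: (probability_setT G).
Qed.

Let tail_cube (i : 'I_d) (t : R) : R := (x ord0 i <= t)%R%:R * cube_piece lo w i t.
Let tail_step (i : 'I_d) (t : R) : R := (x ord0 i <= t)%R%:R * step (a ord0 i) h t.

Let integrable_tail_cube i : leb.-integrable setT (EFin \o tail_cube i).
Proof.
rewrite (_ : tail_cube i = quad_piece (Num.max (x ord0 i) (lo i)) (lo i + w) 0 0 1).
  exact: integrable_quad_piece.
apply/funext => t; rewrite /tail_cube /cube_piece /quad_piece ge_max.
by case: (x ord0 i <= t) => /=; rewrite ?mul1r ?mul0r.
Qed.

Let aboveE v : (\1_(above (fun i => x ord0 i)) v : R) =
  \prod_(i < d) (x ord0 i <= v ord0 i)%R%:R.
Proof.
rewrite indicE; case: (boolP (v \in _)) => [/[!inE] va|/negP/[!inE] va].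
  by rewrite big1// => i _; rewrite va.
have [i vi] : exists i, ~~ (x ord0 i <= v ord0 i).
  by apply/existsP; rewrite -negb_forall; apply/negP => /forallP.
by rewrite (bigD1 i)//= (negbTE vi) mul0r.
Qed.

Let kernel_removed v : kernel v * removed v = kappa * prod_weight tail_cube v.
Proof.
transitivity (\1_(above (fun i => x ord0 i)) v * cube_weight lo w kappa v).
  rewrite removedE /kernel /inv_volume_above.
  case: (pselect (orthant v)) => vO; last by rewrite cube_weight_out// mul0r !mulr0.
  have v0 : volume v != 0 by rewrite gt_eqF// prodr_gt0.
  by rewrite -mulrA; congr (_ * _); rewrite mulrCA mulVf// mulr1.
by rewrite aboveE /cube_weight mulrCA /prod_weight -big_split.
Qed.

Let kernel_signed v : kernel v * signed v = bump_height * prod_weight tail_step v.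
Proof.
rewrite signedE -mulrA mulrA kernel_removed /bump_height -!mulrA.
congr (_ * _); rewrite mulrCA; congr (_ * _).
rewrite /prod_weight -big_split/=; apply: eq_bigr => i _.
rewrite /tail_cube /tail_step -mulrA; congr (_ * _).
case: (boolP (a ord0 i - h <= v ord0 i < a ord0 i + h / 7)) => vi; last first.
  by rewrite step_out// !mulr0.
rewrite /cube_piece /quad_piece ifT; first by ring.
by have hp := h0; rewrite /lo /w; case/andP: vi => ? ?; apply/andP; split; lra.
Qed.

Lemma perturbed_mixture_in :
  smu_mixture perturbed_mixing x = (f x + tent_bump x) / (1 + bump_mass).
Proof.
have mk : measurable_fun setT (EFin \o kernel) by exact/measurable_EFinP.
have k0 v : (0 <= (EFin \o kernel) v)%E by rewrite lee_fin.
rewrite smu_kernel (integral_perturbed_mixing mk k0).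
have e1 : (\int[removed_measure]_v (EFin \o kernel) v =
    (kappa * \prod_(i < d) \int[leb]_t tail_cube i t)%:E)%E.
  rewrite /removed_measure ge0_integral_wmeasure//.
  rewrite -(integral_prod_weight kappa integrable_tail_cube).
  by apply: eq_integral => v _; rewrite /= -EFinM kernel_removed.
have e2 : (\int[added_measure]_v (EFin \o kernel) v =
    (kappa * \prod_(i < d) \int[leb]_t tail_cube i t)%:E + (tent_bump x)%:E)%E.
  rewrite /added_measure ge0_integral_wmeasure//.
  transitivity (\int[@lebesgue_rV R d]_v ((kappa * prod_weight tail_cube v)%:E +
      (bump_height * prod_weight tail_step v)%:E))%E.
    apply: eq_integral => v _.
    by rewrite /= -EFinM /added mulrDr kernel_removed kernel_signed EFinD.
  have its i : leb.-integrable setT (EFin \o tail_step i) by exact: integrable_step_tail.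
  rewrite integralD//; last 2 first.
  - exact: integrable_prod_weight.
  - exact: integrable_prod_weight.
  rewrite !integral_prod_weight//; congr (_ + (_ * _)%:E)%E.
  by apply: eq_bigr => i _; exact: Rintegral_step_tail.
have := integral_M mk k0; rewrite integral_kernel e1 e2.
move: (kappa * _) => I1 E.
rewrite -[X in (_ * X)%E](addeK (x := I1%:E))// E (addeC I1%:E) addeA addeK//.
by rewrite /= mulrC.
Qed.

End mixture_in_orthant.

(** For [x] in the orthant the removed and the added weights contribute tails of
product weights at [x]; the uniform parts cancel, and the tails of the steps are
tents.  Elsewhere both sides vanish, the box being inside the orthant. *)
Lemma perturbed_mixture x :
  smu_mixture perturbed_mixing x = (f x + tent_bump x) / (1 + bump_mass).
Proof.
case: (pselect (orthant x)) => [xO|xO]; first exact: perturbed_mixture_in.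
rewrite smu_mixture_out// fE smu_mixture_out// bump_out ?addr0 ?mul0r// => xb.
by apply: xO => i; apply: lt_le_trans (lo0 i) _; have /andP[] := xb i.
Qed.

Let mass1 : 0 < 1 + bump_mass.
Proof. by rewrite ltr_pwDl// bump_mass_ge0. Qed.

Let perturbed_pdf x : R := (f x + tent_bump x) / (1 + bump_mass).

Let measurable_perturbed_pdf : measurable_fun setT perturbed_pdf.
Proof.
apply: measurable_funM => //; apply: measurable_funD; first exact: measurable_pdf.
exact: measurable_bump.
Qed.

Let perturbed_pdf_ge0 x : 0 <= perturbed_pdf x.
Proof.
by apply: divr_ge0; [rewrite addr_ge0 ?pdf_ge0 ?bump_ge0|exact: ltW].
Qed.

Let integral_perturbed_pdf :
  (\int[@lebesgue_rV R d]_x (perturbed_pdf x)%:E = 1)%E.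
Proof.
have mf := measurable_pdf f; have mb := measurable_bump.
under eq_integral do rewrite /perturbed_pdf EFinM EFinD.
rewrite ge0_integralZr//; last 3 first.
- by apply: emeasurable_funD; exact/measurable_EFinP.
- by move=> x _; rewrite -EFinD lee_fin addr_ge0 ?pdf_ge0 ?bump_ge0.
- by rewrite lee_fin invr_ge0 ltW.
rewrite ge0_integralD//; last 4 first.
- by move=> x _; rewrite lee_fin pdf_ge0.
- exact/measurable_EFinP.
- by move=> x _; rewrite lee_fin bump_ge0.
- exact/measurable_EFinP.
by rewrite integral_pdf integral_bump -EFinD -EFinM divff// gt_eqF.
Qed.

Definition perturbed_density : density R d :=
  Density measurable_perturbed_pdf perturbed_pdf_ge0 integral_perturbed_pdf.

Lemma perturbed_densityE x :
  perturbed_density x = (f x + tent_bump x) / (1 + bump_mass).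
Proof. by []. Qed.

Lemma perturbed_density_SMU : F_SMU perturbed_density.
Proof.
exists perturbed_mixing; split; first exact: perturbed_mixing_orthant.
by move=> x; rewrite perturbed_mixture.
Qed.

Variable fmin : R.
Hypothesis fmin0 : 0 < fmin.
Hypothesis f_ge : forall x, box x -> fmin <= f x.

Definition likelihood_ratio x : R := (1 + tent_bump x / f x) / (1 + bump_mass).

Let relative x : R := tent_bump x / f x.

Let relative_ge0 x : 0 <= relative x.
Proof. by rewrite divr_ge0 ?bump_ge0 ?pdf_ge0. Qed.

Let measurable_relative : measurable_fun setT relative.
Proof.
apply: measurable_funM; first exact: measurable_bump.
exact: (measurableT_comp (@measurable_invr R) (measurable_pdf f)).
Qed.

Let relative_mul x : relative x * f x = tent_bump x.
Proof.
case: (pselect (box x)) => [/f_ge fx|/bump_out b0].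
  by rewrite divfK// gt_eqF// (lt_le_trans fmin0).
by rewrite /relative b0 !mul0r.
Qed.

Let relative_sqr_mul x : relative x ^+ 2 * f x <= fmin^-1 * tent_bump x ^+ 2.
Proof.
rewrite expr2 -mulrA relative_mul.
case: (pselect (box x)) => [/f_ge fx|/bump_out b0].
  rewrite /relative mulrAC -expr2 mulrC ler_wpM2r ?sqr_ge0// lef_pV2//.
  by rewrite posrE (lt_le_trans fmin0).
by rewrite b0 mulr0 expr0n mulr0.
Qed.

Lemma likelihood_ratio_ge0 x : 0 <= likelihood_ratio x.
Proof.
by apply: divr_ge0; [rewrite addr_ge0 ?relative_ge0|exact: ltW].
Qed.

Lemma measurable_likelihood_ratio : measurable_fun setT likelihood_ratio.
Proof.
by apply: measurable_funM => //; apply: measurable_funD => //; exact: measurable_relative.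
Qed.

Let integral_density_law (g : 'rV[R]_d -> \bar R) : measurable_fun setT g ->
  (forall x, 0 <= g x)%E ->
  (\int[density_law f]_x g x = \int[@lebesgue_rV R d]_x (g x * (f x)%:E))%E.
Proof.
move=> mg g0.
by apply: (ge0_integral_density (measurable_pdf f) (pdf_ge0 f)).
Qed.

Lemma density_law_likelihood_ratio A : measurable A ->
  density_law perturbed_density A =
  (\int[density_law f]_(x in A) (likelihood_ratio x)%:E)%E.
Proof.
move=> mA; transitivity (\int[@lebesgue_rV R d]_(x in A) (perturbed_density x)%:E)%E.
  by [].
rewrite [LHS]integral_mkcond [RHS]integral_mkcond integral_density_law.
- apply: eq_integral => x _; rewrite /patch; case: ifPn => _; last by rewrite mul0e.
  rewrite -EFinM perturbed_densityE; congr EFin.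
  rewrite /likelihood_ratio [RHS]mulrAC; congr (_ / _).
  by rewrite mulrDl mul1r -/(relative x) relative_mul.
- apply/(measurable_restrictT (fun x => (likelihood_ratio x)%:E) mA).
  by apply: measurable_funTS; apply/measurable_EFinP; exact: measurable_likelihood_ratio.
- by move=> x; rewrite /patch; case: ifPn => // _; rewrite lee_fin likelihood_ratio_ge0.
Qed.

Let sqrt1D_ge (t : R) : 0 <= t -> 1 + t / 2 <= Num.sqrt (1 + t) + t ^+ 2 / 8.
Proof.
move=> t0; rewrite -lerBlDr.
case: (lerP 0 (1 + t / 2 - t ^+ 2 / 8)) => u0; last by rewrite (le_trans (ltW u0)) ?sqrtr_ge0.
rewrite -[leLHS](ger0_norm u0) -sqrtr_sqr ler_wsqrtr//.
have : 0 <= t ^+ 3 by rewrite exprn_ge0.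
have t8 : t <= 8 by nra.
have : 0 <= t ^+ 3 * (8 - t) by rewrite mulr_ge0 ?exprn_ge0 ?subr_ge0.
by rewrite !exprS expr0; nra.
Qed.

(** Integrating [sqrt (1 + t) >= 1 + t / 2 - t ^ 2 / 8] at the relative change
[t] of the density: [t] has mean [bump_mass], and the normalisation costs
nothing because [1 + m / 2 >= sqrt (1 + m)]. *)
Lemma affinity_ge :
  ((1 - bump_height ^+ 2 * (8 / 21 * h ^+ 3) ^+ d / (8 * fmin))%:E <=
   \int[density_law f]_x (Num.sqrt (likelihood_ratio x))%:E)%E.
Proof.
have ms : measurable_fun setT (fun x => Num.sqrt (likelihood_ratio x)).
  exact: (measurableT_comp (@measurable_sqrtr R) measurable_likelihood_ratio).
have mr := measurable_relative.
have mr2 : measurable_fun setT (fun x => relative x ^+ 2).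
  exact: (measurableT_comp (exprn_measurable 2) mr).
pose s := Num.sqrt (1 + bump_mass).
have s1 : 1 <= s by rewrite -sqrtr1 ler_wsqrtr// lerDl bump_mass_ge0.
have s0 : 0 < s by exact: lt_le_trans s1.
have s2 : s ^+ 2 = 1 + bump_mass by rewrite sqr_sqrtr// ltW.
have int1 : (\int[density_law f]_x ((1 + relative x / 2) / s)%:E =
    ((1 + bump_mass / 2) / s)%:E)%E.
  under eq_integral do rewrite EFinM.
  rewrite ge0_integralZr//; last 3 first.
  - by apply/measurable_EFinP; apply: measurable_funD => //; exact: measurable_funM.
  - by move=> x _; rewrite lee_fin addr_ge0// divr_ge0.
  - by rewrite lee_fin invr_ge0 ltW.
  rewrite EFinM; congr (_ * _)%E.
  under eq_integral do rewrite EFinD EFinM.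
  rewrite ge0_integralD//; last 2 first.
  - by move=> x _; rewrite -EFinM lee_fin divr_ge0.
  - by apply/measurable_EFinP; exact: measurable_funM.
  rewrite integral_cst// mul1e [X in (X + _)%E](_ : _ = 1%E); last first.
    exact: (probability_setT (density_law f)).
  rewrite ge0_integralZr//; last 2 first.
  - exact/measurable_EFinP.
  - by move=> x _; rewrite lee_fin.
  rewrite integral_density_law; last 2 first.
  - exact/measurable_EFinP.
  - by move=> x; rewrite lee_fin.
  under eq_integral do rewrite -EFinM relative_mul.
  by rewrite integral_bump.
have int2 : (\int[density_law f]_x ((relative x ^+ 2) / 8)%:E <=
    (bump_height ^+ 2 * (8 / 21 * h ^+ 3) ^+ d / (8 * fmin))%:E)%E.
  rewrite integral_density_law; last 2 first.
  - by apply/measurable_EFinP; exact: measurable_funM.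
  - by move=> x; rewrite lee_fin divr_ge0// sqr_ge0.
  apply: (@le_trans _ _ (\int[@lebesgue_rV R d]_x ((8 * fmin)^-1%:E * (tent_bump x ^+ 2)%:E))%E).
    apply: ge0_le_integral => //.
    - move=> x _; apply: mule_ge0; rewrite lee_fin ?pdf_ge0//.
      by apply: divr_ge0 => //; exact: sqr_ge0.
    - apply: emeasurable_funM; first by apply/measurable_EFinP; exact: measurable_funM.
      by apply/measurable_EFinP; exact: measurable_pdf.
    - apply/measurable_EFinP; apply: measurable_funM => //.
      exact: (measurableT_comp (exprn_measurable 2) measurable_bump).
    - move=> x _; rewrite -!EFinM lee_fin [leLHS]mulrAC [leLHS]mulrC invfM -[leRHS]mulrA.
      rewrite ler_pM2l ?invr_gt0//.
  rewrite ge0_integralZl//; last 3 first.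
  - by apply/measurable_EFinP; exact: (measurableT_comp (exprn_measurable 2) measurable_bump).
  - by move=> x _; rewrite lee_fin sqr_ge0.
  - by rewrite lee_fin invr_ge0 mulr_ge0// ltW.
  by rewrite integral_bump_sqr -EFinM mulrC.
rewrite EFinB leeBlDr//.
apply: (@le_trans _ _ ((1 + bump_mass / 2) / s)%:E).
  rewrite lee_fin ler_pdivlMr// mul1r.
  by have := sqr_ge0 (s - 1); move: s2; move: bump_mass => m; nra.
rewrite -int1.
apply: (@le_trans _ _ (\int[density_law f]_x ((Num.sqrt (likelihood_ratio x))%:E +
    ((relative x ^+ 2) / 8)%:E))%E).
  apply: ge0_le_integral => //.
  - move=> x _; rewrite lee_fin; apply: divr_ge0; last exact: ltW.
    by apply: addr_ge0 => //; apply: divr_ge0.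
  - apply/measurable_EFinP; apply: measurable_funM => //; apply: measurable_funD => //.
    exact: measurable_funM.
  - by apply: emeasurable_funD; apply/measurable_EFinP => //; exact: measurable_funM.
  - move=> x _; rewrite -EFinD lee_fin /likelihood_ratio -/(relative x).
    rewrite sqrtrM ?addr_ge0// (sqrtrV (ltW mass1)) -/s ler_pdivrMr// mulrDl divfK ?gt_eqF//.
    apply: (le_trans (sqrt1D_ge (relative_ge0 x))).
    by rewrite lerD2l ler_peMr// divr_ge0// sqr_ge0.
rewrite ge0_integralD//.
- apply: leeD; [exact: lexx|exact: int2].
- exact/measurable_EFinP.
- by move=> x _; rewrite lee_fin; apply: divr_ge0 => //; exact: sqr_ge0.
- by apply/measurable_EFinP; exact: measurable_funM.
Qed.

End perturbation.

(** * Constants and asymptotics *)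

Lemma limn_einf_ge (R : realType) (u : (\bar R)^nat) (c : \bar R) N :
  (forall n, (N <= n)%N -> (c <= u n)%E) -> (c <= limn_einf u)%E.
Proof.
move=> cu; rewrite limn_einf_lim; apply: lime_ge; first exact: is_cvg_einfs.
exists N => // m /= Nm; apply: le_ereal_inf_tmp => _ [n /= mn <-].
by apply: cu; exact: leq_trans mn.
Qed.

Lemma cube_root_exists (R : realType) (y : R) N : 0 < y -> (0 < N)%N ->
  exists2 z : R, 0 < z & z ^+ N = y.
Proof.
move=> y0 N0; exists (y `^ N%:R^-1); first exact: powR_gt0.
rewrite -powR_mulrn ?powR_ge0// -powRrM mulVf ?powRr1 ?ltW//.
by rewrite pnatr_eq0 -lt0n.
Qed.

Lemma powR_third_cube (R : realType) (y : R) : 0 <= y -> (y `^ 3^-1) ^+ 3 = y.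
Proof. by move=> y0; rewrite -powR_mulrn ?powR_ge0// -powRrM mulVf ?powRr1. Qed.

(** From [exp (1/32) >= 33/32], whose 32nd power exceeds [8/3]; the rational
bounds in the proof are rounded down squares. *)
Lemma expRN1_le (R : realType) : expR (- 1) <= 3 / 8 :> R.
Proof.
have e1 : 33 / 32 <= expR (32^-1) :> R.
  by apply: le_trans (expR_ge1Dx _); lra.
have e32 : expR (1 : R) = expR (32^-1) ^+ 32.
  by rewrite -expRM_natl divff.
have sq (x y c : R) : 0 <= c -> c <= x -> c ^+ 2 <= x ^+ 2.
  by move=> c0 cx; rewrite lerXn2r// nnegrE// (le_trans c0).
rewrite expRN -[leRHS]invf_div lef_pV2 ?posrE ?expR_gt0//.
rewrite e32 (_ : 32%N = (2 * 2 * 2 * 2 * 2)%N)// !exprM.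
move: (expR _) e1 => x e1.
have x2 : 5317 / 5000 <= x ^+ 2 by nra.
move: (x ^+ 2) x2 => {e1}x x1.
have x2 : 2827 / 2500 <= x ^+ 2 by nra.
move: (x ^+ 2) x2 => {x1}x x1.
have x2 : 6393 / 5000 <= x ^+ 2 by nra.
move: (x ^+ 2) x2 => {x1}x x1.
have x2 : 817 / 500 <= x ^+ 2 by nra.
move: (x ^+ 2) x2 => {x1}x x1.
nra.
Qed.

(** The cube of the announced constant against the cube of the constant that the
two-point bound gives at relative precision [e]: after simplification by
[(3/8)^d * y] it reads [exp (-1) / 3 <= (11/39)^3 * (28/5) * (1 - e)^5]. *)
Lemma constant_le (R : realType) (d : nat) (y e : R) : (0 < d)%N -> 0 <= y ->
  0 <= e <= 1 / 1000 ->
  (expR (- 3^-1) / 2 ^+ d * (3 ^+ d.-1) `^ 3^-1 * y `^ 3^-1) ^+ 3 <=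
  (11 / 39) ^+ 3 * ((1 - e) ^+ 5 * (28 / 5 * (3 / 8) ^+ d * y)).
Proof.
move=> d0 y0 /andP[e0 e1].
have -> : (expR (- 3^-1) / 2 ^+ d * (3 ^+ d.-1) `^ 3^-1 * y `^ 3^-1) ^+ 3 =
    expR (- 1) * (8 ^+ d)^-1 * (3 ^+ d / 3) * y :> R.
  rewrite !exprMn powR_third_cube ?exprn_ge0// powR_third_cube//.
  congr (_ * _ * _ * _).
  - by rewrite -expRM_natl mulrN divff.
  - by rewrite exprVn -exprM mulnC exprM; congr (_ ^+ _)^-1; ring.
  - by rewrite -[in RHS](prednK d0) exprS mulrC mulKf.
have e5 : 199 / 200 <= (1 - e) ^+ 5.
  apply: le_trans (bernoulli_ineq 5 _); last by apply/andP; split; lra.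
  lra.
have := expRN1_le R; have := expR_ge0 (- 1 : R).
rewrite (expr_div_n (3 : R) 8).
have t0 : 0 <= 3 ^+ d / 8 ^+ d * y by rewrite mulr_ge0// divr_ge0// exprn_ge0.
rewrite (_ : _ * _ * _ * y = expR (- 1) / 3 * (3 ^+ d / 8 ^+ d * y)); last by field.
rewrite (_ : (11 / 39) ^+ 3 * _ =
  ((11 / 39) ^+ 3 * (28 / 5) * (1 - e) ^+ 5) * (3 ^+ d / 8 ^+ d * y)); last by ring.
move: ((1 - e) ^+ 5) e5 => u u1 v0 v1; rewrite ler_wpM2r//; lra.
Qed.

Section local_bounds.
Variables (R : realType) (d : nat).
Implicit Types (x : 'rV[R]_d) (g : 'rV[R]_d -> R).

Definition around x h : set 'rV[R]_d :=
  closed_box (fun i => x ord0 i - h) (fun i => x ord0 i - h + 2 * h).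

Lemma aroundS x h h' : h <= h' -> around x h `<=` around x h'.
Proof. by move=> hh y yx i; have /andP[? ?] := yx i; apply/andP; split; lra. Qed.

Lemma around_continuous_gt x g (c : R) : {for x, continuous g} -> c < g x ->
  exists2 eta, 0 < eta & forall y, around x eta y -> c < g y.
Proof.
move=> gx cg.
have : \forall y \near x, c < g y by exact: (cvgr_gt (g x) gx).
move=> /nbhs_ballP[eta /= eta0 H]; exists (eta / 2); first by rewrite divr_gt0.
move=> y yx; apply: H; split=> // i j; rewrite ord1 /ball /= ltr_norml.
by have /andP[? ?] := yx j; apply/andP; split; lra.
Qed.

Lemma around_euclidean_ball x (r : R) : 0 < r ->
  exists2 eta, 0 < eta & around x eta `<=` euclidean_ball x r.
Proof.
move=> r0; exists (r / d.+1%:R); first by rewrite divr_gt0.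
move=> y yx; rewrite /euclidean_ball /=.
have e0 : 0 <= r / d.+1%:R by rewrite divr_ge0// ltW.
apply: (@le_lt_trans _ _ (\sum_(i < d) (r / d.+1%:R) ^+ 2)).
  apply: ler_sum => i _; have /andP[] := yx i.
  move: (r / _) e0 (y ord0 i) (x ord0 i) => e e0 u v *; nra.
rewrite sumr_const card_ord -[ltLHS]mulr_natr expr_div_n mulrAC ltr_pdivrMr ?exprn_gt0//.
rewrite ltr_pM2l ?exprn_gt0// -natrX ltr_nat.
by rewrite (@leq_trans (d.+1 ^ 1))// leq_pexp2l.
Qed.

Lemma iter_partial_existsS (A B : set 'rV[R]_d) (s : seq 'I_d) g : A `<=` B ->
  iter_partial_exists B s g -> iter_partial_exists A s g.
Proof.
move=> AB; elim: s => //= i s IH [/IH es di]; split; first exact: es.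
by move=> x /AB; exact: di.
Qed.

End local_bounds.

Section local_minimax.
Variables (R : realType) (d : nat) (x0 : 'rV[R]_d) (f : density R d).
Hypotheses (d0 : (0 < d)%N) (fF : F_SMU f).
Variables (h kappa fmin : R) (n : nat).
Hypotheses (h0 : 0 < h) (kappa0 : 0 < kappa) (fmin0 : 0 < fmin) (n0 : (0 < n)%N).
Hypothesis posA : around x0 h `<=` orthant.
Hypothesis fex : mixed_partial_exists (around x0 h) f.
Hypothesis fmix :
  forall y, around x0 h y -> kappa <= (-1) ^+ d * mixed_partial f y.
Hypothesis f_ge : forall x, around x0 h x -> fmin <= f x.
Hypothesis hn :
  bump_height d kappa ^+ 2 * (8 / 21 * h ^+ 3) ^+ d / (8 * fmin) = (10 * n%:R)^-1.

Let lo0 i : 0 < x0 ord0 i - h.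
Proof.
have : around x0 h (\row_i (x0 ord0 i - h)).
  by move=> j; have hp := h0; rewrite mxE; apply/andP; split; lra.
by move=> /posA /(_ i); rewrite mxE.
Qed.

(** The hypothesis on [n] says that the loss of affinity is at most
[1 / (10 n)].  The factor [c] is the rate: scaling the estimator by [c] reduces
to [c = 1]. *)
Lemma local_minimax (c : R) : 0 <= c ->
  exists2 g : density R d, F_SMU g &
    g x0 - f x0 = (bump_height d kappa * h ^+ d - bump_mass d h kappa * f x0)
                  / (1 + bump_mass d h kappa) /\
    forall S : n.-tuple 'rV[R]_d -> R, measurable_fun setT S ->
    ((11 / 39 * (c * (g x0 - f x0)))%:E <= maxe
      'E_(iid_law (density_law g) n)[(fun X => c * `|S X - g x0|)%R]
      'E_(iid_law (density_law f) n)[(fun X => c * `|S X - f x0|)%R])%E.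
Proof.
move=> c0; have k0 := ltW kappa0; have [G [GO fE]] := fF.
pose g := perturbed_density x0 h0 k0 f; exists g.
  exact: (perturbed_density_SMU d0 h0 k0 lo0 GO fE fex fmix).
have m0 := bump_mass_ge0 d h k0.
split.
  rewrite /g perturbed_densityE bump_peak//.
  have ? : 1 + bump_mass d h kappa != 0 by rewrite gt_eqF// ltr_pwDl.
  by field.
move=> S mS.
have aff := affinity_ge h0 k0 fmin0 f_ge; rewrite hn in aff.
have mcS : measurable_fun setT (fun X => c * S X) by exact: measurable_funM.
have := two_point_risk (measurable_likelihood_ratio x0 h kappa f)
  (likelihood_ratio_ge0 x0 h0 k0 f)
  (@density_law_likelihood_ratio R d x0 h kappa h0 k0 f fmin fmin0 f_ge)
  n0 aff (c * g x0) (c * f x0) mcS.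
have E b : (fun X => `|c * S X - c * b|) = (fun X => c * `|S X - b|).
  by apply/funext => X; rewrite -mulrBr normrM ger0_norm.
rewrite !E; apply: le_trans; rewrite lee_fin -mulrBr ler_wpM2l// ler_norm//.
Qed.

End local_minimax.

(** The mass correction is negligible: [bump_mass] is at most [h] times the
height of the bump, which is itself at most [kappa]. *)
Lemma separation_ge (R : realType) (d : nat) (h kappa f0 e : R) :
  (0 < d)%N -> 0 < h <= 1 -> 0 < kappa -> 0 < f0 -> 0 <= e <= 1 ->
  h * (f0 + kappa) <= e ->
  (1 - e) * (bump_height d kappa * h ^+ d) <=
  (bump_height d kappa * h ^+ d - bump_mass d h kappa * f0) /
  (1 + bump_mass d h kappa).
Proof.
move=> d0 /andP[h0 h1] k0 f0p /andP[e0 e1] he.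
have c0 : 0 < bump_height d kappa by rewrite mulr_gt0// invr_gt0 exprn_gt0.
have ck : bump_height d kappa <= kappa.
  rewrite /bump_height; apply: ler_piMr; first exact: ltW.
  by rewrite invf_le1 ?exprn_gt0// exprn_ege1// ler1n.
have hd1 : h ^+ d <= h by rewrite -{2}[h]expr1; apply: ler_wiXn2l => //; exact: ltW.
have hd0 : 0 < h ^+ d by rewrite exprn_gt0.
have mE : bump_mass d h kappa = (bump_height d kappa * h ^+ d) * ((4 / 7) ^+ d * h ^+ d).
  by rewrite /bump_mass expr2 !exprMn; ring.
have q1 : (4 / 7) ^+ d <= 1 :> R by rewrite exprn_ile1//; lra.
have q0 : 0 <= (4 / 7) ^+ d :> R by rewrite exprn_ge0.
set B := bump_height d kappa * h ^+ d in mE *.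
have B0 : 0 < B by rewrite mulr_gt0.
have Bk : B <= kappa by rewrite /B; nra.
have qh : (4 / 7) ^+ d * h ^+ d <= h by nra.
have qh0 : 0 <= (4 / 7) ^+ d * h ^+ d by rewrite mulr_ge0// ltW.
move: mE qh qh0; move: (bump_mass d h kappa) => m; move: (_ * h ^+ d) => t -> th t0.
have m1 : 0 < 1 + B * t by rewrite ltr_pwDl// mulr_ge0// ltW.
rewrite ler_pdivlMr//.
have -> : B - B * t * f0 = B * (1 - t * f0) by ring.
rewrite mulrAC mulrC ler_pM2l//.
have : t * f0 <= h * f0 by rewrite ler_wpM2r// ltW.
have : B * t <= kappa * h by rewrite ler_pM// ltW.
have : 0 <= e * (B * t) by rewrite !mulr_ge0// ltW.
move: he; rewrite mulrDr (mulrC h kappa) (mulrC h f0) mulrDr mulr1 mulrBl mul1r.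
by move: (B * t) (t * f0) => *; lra.
Qed.

(** The value of [h ^ (3 * d)] is the one for which the affinity bound is exactly
[1 - 1 / (10 n)]; the cube of the height is then determined. *)
Lemma limiting_constant (R : realType) (d : nat) (h kappa fmin : R) n :
  (0 < d)%N -> (0 < n)%N -> 0 < kappa -> 0 < fmin ->
  h ^+ (3 * d) =
    (4 / 5 * fmin) / (bump_height d kappa ^+ 2 * (8 / 21) ^+ d) / n%:R ->
  bump_height d kappa ^+ 2 * (8 / 21 * h ^+ 3) ^+ d / (8 * fmin) =
    (10 * n%:R)^-1 /\
  n%:R * (bump_height d kappa * h ^+ d) ^+ 3 =
    28 / 5 * (3 / 8) ^+ d * (kappa * fmin).
Proof.
move=> d0 n0 k0 f0 hE.
have n1 : n%:R != 0 :> R by rewrite pnatr_eq0 -lt0n.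
have c0 : bump_height d kappa != 0.
  by rewrite gt_eqF// mulr_gt0// invr_gt0 exprn_gt0.
have q0 : (8 / 21) ^+ d != 0 :> R by rewrite expf_neq0//; lra.
have fn : fmin != 0 by rewrite gt_eqF.
split.
  rewrite [(8 / 21 * h ^+ 3) ^+ d]exprMn -exprM hE.
  move: (bump_height d kappa) c0 ((8 / 21) ^+ d) q0 => c c0 q q0; field.
  by rewrite n1 fn c0 q0.
rewrite [(bump_height d kappa * h ^+ d) ^+ 3]exprMn -exprM (mulnC d) hE.
rewrite (_ : (3 / 8) ^+ d = (7 ^+ d)^-1 / (8 / 21) ^+ d); last first.
  by rewrite -!exprVn -exprMn; congr (_ ^+ _); field.
have cE : bump_height d kappa = kappa * 7 / 7 ^+ d.
  rewrite /bump_height -mulrA; congr (_ * _).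
  by rewrite -[in RHS](prednK d0) exprS invfM mulrA divff// mul1r.
have p0 : 7 ^+ d != 0 :> R by rewrite expf_neq0.
rewrite [bump_height d kappa ^+ 3]exprS {1}cE.
move: (bump_height d kappa) c0 ((8 / 21) ^+ d) q0 (7 ^+ d) p0 => c c0 q q0 p p0.
by field; rewrite n1 c0 q0 p0.
Qed.

Theorem proposition4p1 (R : realType) (d : nat) (hd : (0 < d)%N)
    (x0 : 'rV[R]_d) (hx0 : orthant x0)
    (f : density R d) (hf : F_SMU f)
    (hfC1 : continuously_differentiable_at f x0) (hfx0 : 0 < f x0)
    (r : R) (hr : 0 < r) (hA : euclidean_ball x0 r `<=` orthant)
    (hfpos : forall y, euclidean_ball x0 r y -> 0 < f y)
    (hpartial : forall (j : 'I_d) y, euclidean_ball x0 r y ->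
      derivable f y (delta_mx ord0 j) /\ {for y, continuous (partial j f)})
    (hpartial_neg : forall j : 'I_d, partial j f x0 < 0)
    (hmixed : mixed_partial_exists (euclidean_ball x0 r) f)
    (hmixed_cont : forall y, euclidean_ball x0 r y ->
      {for y, continuous (mixed_partial f)})
    (hmixed_sign : forall y, euclidean_ball x0 r y ->
      0 < (-1) ^+ d * mixed_partial f y) :
  exists f_ : nat -> density R d,
    (forall n, F_SMU (f_ n)) /\
    forall T : (forall n, n.-tuple 'rV[R]_d -> R),
      (forall n, measurable_fun [set: n.-tuple 'rV[R]_d] (T n)) ->
      ((expR (- 3^-1) / 2 ^+ d * (3 ^+ d.-1) `^ 3^-1 *
          ((-1) ^+ d * mixed_partial f x0 * f x0) `^ 3^-1)%:E <=
       limn_einf (fun n => maxe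
         'E_(iid_law (density_law (f_ n)) n)
            [(fun X => n%:R `^ 3^-1 * `|T n X - f_ n x0|)%R]
         'E_(iid_law (density_law f) n)
            [(fun X => n%:R `^ 3^-1 * `|T n X - f x0|)%R]))%E.
Proof.
have x0A : euclidean_ball x0 r x0.
  rewrite /euclidean_ball /= big1 ?exprn_gt0// => i _.
  by rewrite subrr expr0n.
pose e : R := 1 / 1000.
have e01 : 0 <= e <= 1 / 1000 by rewrite /e; apply/andP; split; lra.
pose g0 := (-1) ^+ d * mixed_partial f x0.
have g00 : 0 < g0 by exact: hmixed_sign.
pose kappa := (1 - e) * g0; pose fmin := (1 - e) * f x0.
have k0 : 0 < kappa by rewrite mulr_gt0// /e; lra.
have m0 : 0 < fmin by rewrite mulr_gt0// /e; lra.
have kg : kappa < g0 by rewrite /kappa /e; lra.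
have mf : fmin < f x0 by rewrite /fmin /e; lra.
have [eta1 eta10 H1] := around_euclidean_ball x0 hr.
have [eta2 eta20 H2] : exists2 eta, 0 < eta &
    forall y, around x0 eta y -> kappa < (-1) ^+ d * mixed_partial f y.
  apply: (@around_continuous_gt R d x0 (fun y => (-1) ^+ d * mixed_partial f y)) => //.
  have cc : {for x0, continuous (cst ((-1) ^+ d) : 'rV[R]_d -> R)}.
    exact: cst_continuous.
  exact: (continuousM cc (hmixed_cont _ x0A)).
have fc : {for x0, continuous f}.
  by case: hfC1 => /nbhs_singleton /differentiable_continuous.
have [eta3 eta30 H3] := around_continuous_gt fc mf.
pose eta := Num.min (Num.min eta1 eta2) (Num.min eta3 (Num.min 1 (e / (f x0 + kappa)))).
have fk0 : 0 < f x0 + kappa by rewrite addr_gt0.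
have eta0 : 0 < eta.
  by rewrite !lt_min eta10 eta20 eta30 ltr01 divr_gt0// /e; lra.
pose A := (4 / 5 * fmin) / (bump_height d kappa ^+ 2 * (8 / 21) ^+ d).
have A0 : 0 < A.
  have bh0 : 0 < bump_height d kappa by rewrite mulr_gt0// invr_gt0 exprn_gt0.
  have q0 : 0 < 8 / 21 :> R by lra.
  by apply: divr_gt0; rewrite mulr_gt0// ?exprn_gt0//; lra.
pose N := (Num.truncn (A / eta ^+ (3 * d))).+1.
pose C := expR (- 3^-1) / 2 ^+ d * (3 ^+ d.-1) `^ 3^-1 * (g0 * f x0) `^ 3^-1.
have key n : exists g : density R d, F_SMU g /\ ((N <= n)%N ->
    forall S : n.-tuple 'rV[R]_d -> R, measurable_fun setT S ->
    (C%:E <= maxe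
      'E_(iid_law (density_law g) n)[(fun X => n%:R `^ 3^-1 * `|S X - g x0|)%R]
      'E_(iid_law (density_law f) n)[(fun X => n%:R `^ 3^-1 * `|S X - f x0|)%R])%E).
  case: (leqP N n) => [Nn|]; last by move=> nN; exists f; split.
  have n0 : (0 < n)%N by exact: leq_trans Nn.
  have nR : 0 < n%:R :> R by rewrite ltr0n.
  have d3 : (0 < 3 * d)%N by rewrite muln_gt0.
  have [h h0 hE] := cube_root_exists (divr_gt0 A0 nR) d3.
  have heta : h <= eta.
    rewrite -(ler_pXn2r d3) ?nnegrE; [|exact: ltW|exact: ltW].
    rewrite hE ler_pdivrMr//.
    rewrite mulrC -ler_pdivrMr ?exprn_gt0//.
    apply: ltW; apply: (lt_le_trans (truncnS_gt _)).
    by rewrite ler_nat.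
  have [he1 he2 he3 he4 he5] : [/\ h <= eta1, h <= eta2, h <= eta3, h <= 1 &
      h <= e / (f x0 + kappa)].
    move: heta; rewrite !le_min => /andP[/andP[? ?] /andP[? /andP[? ?]]].
    by split.
  have [hn hlim] := limiting_constant hd n0 k0 m0 hE.
  have sub : around x0 h `<=` euclidean_ball x0 r.
    by apply: subset_trans H1; exact: aroundS.
  have c0 : 0 <= n%:R `^ 3^-1 :> R by exact: powR_ge0.
  have [g gF [gE gR]] := local_minimax hd hf h0 k0 m0 n0
    (subset_trans sub hA) (iter_partial_existsS sub hmixed)
    (fun y yx => ltW (H2 y (aroundS he2 yx)))
    (fun y yx => ltW (H3 y (aroundS he3 yx))) hn c0.
  exists g; split=> // _ S mS; apply: le_trans (gR S mS); rewrite lee_fin.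
  have sep : (1 - e) * (bump_height d kappa * h ^+ d) <= g x0 - f x0.
    rewrite gE; apply: separation_ge => //; first by rewrite h0.
    - by case/andP: e01 => -> ?; lra.
    - by rewrite -ler_pdivlMr.
  have B0 : 0 <= (1 - e) * (bump_height d kappa * h ^+ d).
    apply: mulr_ge0; first by rewrite /e; lra.
    apply: mulr_ge0; last exact/exprn_ge0/ltW.
    by apply: mulr_ge0; [exact: ltW|rewrite invr_ge0 exprn_ge0].
  have three : (0 < 3)%N by [].
  rewrite -(ler_pXn2r three) ?nnegrE; last 2 first.
  - by rewrite !mulr_ge0 ?expR_ge0 ?powR_ge0 ?invr_ge0 ?exprn_ge0.
  - by rewrite !mulr_ge0// (le_trans B0).
  apply: (le_trans (constant_le hd _ e01)); first by rewrite ltW// mulr_gt0.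
  rewrite [leRHS]exprMn ler_wpM2l ?exprn_ge0// [leRHS]exprMn powR_third_cube//.
  apply: (@le_trans _ _ (n%:R * ((1 - e) * (bump_height d kappa * h ^+ d)) ^+ 3)).
    rewrite [X in _ <= _ * X]exprMn [leRHS]mulrCA hlim /kappa /fmin.
    by rewrite le_eqVlt; apply/orP; left; apply/eqP; ring.
  by rewrite (ler_wpM2l (ltW nR))// lerXn2r// nnegrE (le_trans B0).
have [f_ f_P] := choice key.
exists f_; split=> [n|T mT]; first by case: (f_P n).
apply: (@limn_einf_ge _ _ _ N) => n Nn.
by have [_ /(_ Nn (T n) (mT n))] := f_P n.
Qed.
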